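(* Fix an integer $\nu\ge1$ and $p\in\mathbb R$. Say that the approximation rate with power $p$ is achieved if for each positive integer $W$ there is a ReLU network architecture $\eta_W$ with $\nu$ inputs and $W$ weights and a weight assignment $f\mapsto$ (weights of $\eta_W$), producing network functions $\widetilde f_W$, such that $$\|f-\widetilde f_W\|_\infty\le a\,\omega_f(cW^{-p})\quad \text{for all } f\in C([0,1]^\nu)\text{ and all } W,$$ with constants $a,c$ (possibly depending on $\nu,p$) independent of $W$ and $f$. Then: (a) The approximation rate with power $p$ cannot be achieved if $p>\frac{2}{\nu}$. (b) The approximation rate with power $p$ cannot be achieved if $p>\frac1\nu$ and the weights of $\widetilde f_W$ are required to depend continuously on $f$ with respect to the standard (sup-norm) topology of $C([0,1]^\nu)$. (c) If the approximation rate with power $p$ is achieved for some $p\in(\frac1\nu,\frac2\nu]$, then the architectures $\eta_W$ must have depths $L\ge d\,W^{p\nu-1}/\ln W$ with some constant $d>0$ possibly depending on $\nu$ and $p$.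
   Context: For $f:[0,1]^\nu\to\mathbb R$ continuous, $\omega_f(r)=\max\{|f(\mathbf x)-f(\mathbf y)|:\mathbf x,\mathbf y\in[0,1]^\nu,\ |\mathbf x-\mathbf y|\le r\}$ (Euclidean norm). A ReLU network is a feed-forward network with $\nu$ input units, hidden units grouped into a sequence of layers (each unit taking inputs from outputs of units in earlier layers, arbitrary such connections allowed), and one output unit. A hidden unit computes $(x_1,\dots,x_s)\mapsto(\sum_kw_kx_k+h)_+$, $t_+=\max(0,t)$; the output unit computes $\sum_kw_kx_k+h$. The depth $L$ is the number of hidden layers; the number of weights $W$ is the number of connections plus the number of computation (hidden and output) units. A weight assignment is a rule choosing all weight values of $\eta_W$ depending on $f$, and $\widetilde f_W$ is the resulting network function. $\|\cdot\|_\infty$ is the sup norm on $[0,1]^\nu$.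
   Formalization: In (c) the depth bound is claimed only for all sufficiently large W (at W=1, ln W=0; at W=2 a depth-0 constant network is compatible with the rate), and d and the threshold are chosen for the given family of architectures and weight assignments. *)

(* Defs.v *)
From HB Require Import structures.
From mathcomp Require Import all_boot all_order all_algebra.
From mathcomp Require Import all_classical all_reals all_analysis.
Set Implicit Arguments. Unset Strict Implicit. Unset Printing Implicit Defensive.
Import Order.TTheory GRing.Theory Num.Theory.
Local Open Scope ring_scope.
Local Open Scope classical_set_scope.

Section Cube.
Variables (R : realType) (nu : nat).

Definition in_cube (x : 'I_nu -> R) : Prop := forall i, 0 <= x i <= 1.

Definition edist (x y : 'I_nu -> R) : R := Num.sqrt (\sum_(i < nu) (x i - y i) ^+ 2).

Definition cont_cube (f : ('I_nu -> R) -> R) : Prop :=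
  forall x, in_cube x -> forall eps : R, 0 < eps -> exists2 delta : R, 0 < delta &
    forall y, in_cube y -> edist x y < delta -> `|f x - f y| < eps.

Definition omega (f : ('I_nu -> R) -> R) (r : R) : R :=
  sup [set z : R | exists x y, [/\ in_cube x, in_cube y, edist x y <= r &
                                     z = `|f x - f y|]].

Definition supnorm (g : ('I_nu -> R) -> R) : R :=
  sup [set z : R | exists2 x, in_cube x & z = `|g x|].
End Cube.

(* Hidden units are 'I_nh; unit u lies in layer [lay u], 1 <= lay u <= depth,
   every layer is nonempty.  Unit u receives connections from the input units
   [in_i u] and from the hidden units [in_h u], which must lie in earlier
   layers; the output unit receives connections from [out_i] and [out_h]. *)
Record arch (nu : nat) := Arch {
  nh : nat;
  depth : nat;
  lay : 'I_nh -> nat;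
  in_i : 'I_nh -> {set 'I_nu};
  in_h : 'I_nh -> {set 'I_nh};
  out_i : {set 'I_nu};
  out_h : {set 'I_nh};
  lay_range : forall u, (1 <= lay u <= depth)%N;
  lay_nonempty : forall l, (1 <= l <= depth)%N -> exists u, lay u = l;
  in_h_earlier : forall u v, v \in in_h u -> (lay v < lay u)%N }.
Arguments nh {nu} a.
Arguments depth {nu} a.
Arguments lay {nu} a u.
Arguments in_i {nu} a u.
Arguments in_h {nu} a u.
Arguments out_i {nu} a.
Arguments out_h {nu} a.

(* number of weights = number of connections + number of computation units *)
Definition nweights nu (A : arch nu) : nat :=
  (\sum_(u < nh A) (#|in_i A u| + #|in_h A u|) + #|out_i A| + #|out_h A|
   + nh A + 1)%N.

(* weight values for an architecture with nu inputs and N hidden units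
   (values on absent connections are irrelevant) *)
Record weights (R : realType) (nu N : nat) := Weights {
  wi : 'I_N -> 'I_nu -> R;   (* input i -> hidden u *)
  wh : 'I_N -> 'I_N -> R;    (* hidden v -> hidden u *)
  bh : 'I_N -> R;            (* bias of hidden u *)
  woi : 'I_nu -> R;          (* input i -> output *)
  woh : 'I_N -> R;           (* hidden v -> output *)
  bo : R }.                  (* bias of output *)
Arguments wi {R nu N} w u i.
Arguments wh {R nu N} w u v.
Arguments bh {R nu N} w u.
Arguments woi {R nu N} w i.
Arguments woh {R nu N} w v.
Arguments bo {R nu N} w.

Section Net.
Variables (R : realType) (nu : nat) (A : arch nu) (th : weights R nu (nh A)).

Definition relu (t : R) : R := Num.max 0 t.

Definition hidden_step (x : 'I_nu -> R) (h : 'I_(nh A) -> R) : 'I_(nh A) -> R :=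
  fun u => relu (\sum_(i in in_i A u) wi th u i * x i
                 + \sum_(v in in_h A u) wh th u v * h v + bh th u).

(* After k iterations every unit of layer <= k holds its correct output;
   hence after [depth A] iterations all hidden outputs are correct. *)
Definition hidden_vals (x : 'I_nu -> R) : 'I_(nh A) -> R :=
  iter (depth A) (hidden_step x) (fun _ => 0).

Definition net (x : 'I_nu -> R) : R :=
  \sum_(i in out_i A) woi th i * x i
  + \sum_(v in out_h A) woh th v * hidden_vals x v + bo th.
End Net.

Definition weights_close (R : realType) nu (A : arch nu)
    (t1 t2 : weights R nu (nh A)) (eps : R) : Prop :=
  [/\ forall u i, i \in in_i A u -> `|wi t1 u i - wi t2 u i| < eps,
      forall u v, v \in in_h A u -> `|wh t1 u v - wh t2 u v| < eps,
      forall u, `|bh t1 u - bh t2 u| < eps &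
      [/\ forall i, i \in out_i A -> `|woi t1 i - woi t2 i| < eps,
      forall v, v \in out_h A -> `|woh t1 v - woh t2 v| < eps &
      `|bo t1 - bo t2| < eps]].

Definition assign_continuous (R : realType) nu (A : arch nu)
    (asg : (('I_nu -> R) -> R) -> weights R nu (nh A)) : Prop :=
  forall f, cont_cube f -> forall eps : R, 0 < eps -> exists2 delta : R, 0 < delta &
    forall g, cont_cube g -> supnorm (fun x => f x - g x) < delta ->
      weights_close (asg f) (asg g) eps.

Definition rate_ok (R : realType) nu (p : R) (eta : nat -> arch nu)
    (asg : forall W : nat, (('I_nu -> R) -> R) -> weights R nu (nh (eta W))) : Prop :=
  exists a c : R, [/\ 0 < a, 0 < c,
    forall W : nat, (0 < W)%N -> nweights (eta W) = W &
    forall (W : nat) (f : ('I_nu -> R) -> R), (0 < W)%N -> cont_cube f ->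
      forall x, in_cube x ->
        `|f x - net (asg W f) x| <= a * omega f (c * (W%:R `^ (- p)))].

Definition rate_achieved (R : realType) nu (p : R) : Prop :=
  exists eta asg, @rate_ok R nu p eta asg.

Definition rate_achieved_cont (R : realType) nu (p : R) : Prop :=
  exists eta asg, @rate_ok R nu p eta asg /\
    forall W : nat, (0 < W)%N -> assign_continuous (asg W).
Arguments rate_ok {R nu} p eta asg.

(* Main.v *)
Require Import Defs.
From HB Require Import structures.
From mathcomp Require Import all_boot all_order all_algebra.
From mathcomp Require Import fingroup perm.
From mathcomp Require Import all_classical all_reals all_analysis.
From mathcomp Require Import ring lra zify.
Set Implicit Arguments. Unset Strict Implicit. Unset Printing Implicit Defensive.
Import Order.TTheory GRing.Theory Num.Theory.
Import numFieldNormedType.Exports.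
Local Open Scope ring_scope.

(** A rate-[p] approximation forces the architecture with [W] weights to reproduce, up to
    error 1/2, arbitrary data in [-1, 1] prescribed at about [W^(p nu)] grid points, the data
    being extended to functions of Lipschitz constant about [W^p].
    - For data 1 and -1 the architecture thus shatters [W^(p nu)] points.  Conversely, once the
      signs of all pre-activations at [N] points are fixed, the outputs are polynomials in the
      weights, and the signs can be fixed one layer after the other; [m] polynomials of
      degree [d] in [W] variables have at most [(2md + 1)^W] sign patterns, so that [2^N] is at
      most [(N W^2)^O(W L)].  This yields (c), and (a) since [L <= W].
    - The bound on sign patterns: every sign cell contains a critical point of
      [prod p_i^2 - eta sum x_j^(E+1)], a solution of a system [x_j^E = r_j(x)] with
      [deg r_j < E], and such a system has at most [E^W] solutions.
    - If the weights depend continuously on the data [y] in the cube of dimension [W + 1], then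
      the values of the network at the [W + 1] points form a continuous map within 1/2 of the
      identity, which by the Poincare-Miranda theorem attains all [K^(W+1)] points of a fine
      grid.  But the count of sign patterns allows only [O(K^W)] of them.
    - Poincare-Miranda is proved on the Kuhn triangulation of a grid: the sum over all simplices
      of the oriented determinants of the vertex labels depends, by a Stokes formula, only on
      the labels on the sides of the cube, so it equals that of the labels [0 < x_i], which
      is [N!]; hence some simplex has a nonzero determinant. *)

(** * Discrete and continuous Poincare-Miranda theorem *)

Section GridMiranda.
Variables (n k : nat).
Local Notation N := n.+1.
Local Notation K := k.+1.
Implicit Types (v : {ffun 'I_N -> 'I_K}) (s : 'S_N).

(** The simplex of [s] in the cell [v] is a monotone path from the lowest to the highest corner of
    the cell; [s i] is the time at which coordinate [i] is raised. *)
Definition kuhn_vertex v s (m : nat) : {ffun 'I_N -> nat} :=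
  [ffun i => (v i + (s i < m))%N].

Definition kuhn_face v s (m : 'I_N.+1) : {ffun 'I_N -> {ffun 'I_N -> nat}} :=
  [ffun l => kuhn_vertex v s (lift m l)].

Definition on_side (i : 'I_N) (x : nat) (w : {ffun 'I_N -> {ffun 'I_N -> nat}}) :=
  forall l, w l i = x.

Section Stokes.
Variable c : {ffun 'I_N -> {ffun 'I_N -> nat}} -> int.
Hypothesis c_side : forall w i, on_side i 0 w \/ on_side i K w -> c w = 0.

(** A face without its inner vertex [m] does not reveal which of the times [m - 1] and [m] belongs
    to which coordinate. Swapping the two times changes the sign of [s] but not the face, so the
    terms cancel in pairs within one cell. *)
Lemma sum_inner_face v (m : 'I_N.+1) : m != ord0 -> m != ord_max ->
  \sum_(s : 'S_N) (-1) ^+ s * c (kuhn_face v s m) = 0.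
Proof.
move=> m0 mN.
have lt1 : (m.-1 < N)%N.
  by rewrite -ltnS prednK ?lt0n // ltnS ltnW.
have lt2 : (m < N)%N.
  by rewrite ltn_neqAle -ltnS ltn_ord andbT; apply: contraNneq mN => e; apply/eqP/val_inj.
pose a := Ordinal lt1; pose b := Ordinal lt2.
have ab : a != b.
  by rewrite -val_eqE /= neq_ltn prednK ?lt0n // leqnn.
pose t := tperm a b.
pose F (s : 'S_N) := (-1) ^+ s * c (kuhn_face v s m) : int.
have Ft s : F (s * t)%g = - F s.
  rewrite /F odd_permM odd_tperm ab addbT signrN mulNr; congr (- (_ * c _)).
  apply/ffunP => l; rewrite !ffunE; apply/ffunP => i; rewrite !ffunE.
  congr (_ + nat_of_bool _)%N; rewrite permM.
  have key (x : nat) : x != m :> nat -> (a < x)%N = (b < x)%N.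
    rewrite /= => xm; rewrite prednK ?lt0n //.
    by rewrite leq_eqVlt eq_sym (negbTE xm).
  have lm : (lift m l : nat) != m by rewrite eq_sym; exact: neq_lift.
  by rewrite /t; case: tpermP => [->|->|//]; rewrite key.
have E : \sum_s F s = - \sum_s F s.
  rewrite -sumrN (reindex_inj (mulIg t)) /=.
  by apply: eq_bigr => s _; rewrite Ft.
by apply/eqP; move/eqP: E; rewrite -addr_eq0 -mulr2n mulrn_eq0.
Qed.

Definition kuhn_cyc : 'S_N := lift_perm ord0 ord_max 1.

Lemma kuhn_cycE (i : 'I_N) : kuhn_cyc i = (if i == ord0 then n else i.-1) :> nat.
Proof.
rewrite /kuhn_cyc; case: (unliftP ord0 i) => [j ->|->].
  by rewrite lift_perm_lift perm1 /= /bump leqNgt ltn_ord add0n.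
by rewrite lift_perm_id eqxx.
Qed.

(** The simplex on the other side of the face opposite to vertex 0: the coordinate raised first is
    moved into the base corner and is raised last instead. The cyclic [ordS] makes this an injection
    on all pairs. *)
Definition kuhn_shift (p : {ffun 'I_N -> 'I_K} * 'S_N) : {ffun 'I_N -> 'I_K} * 'S_N :=
  ([ffun i => if p.2 i == ord0 then ordS (p.1 i) else p.1 i], (p.2 * kuhn_cyc)%g).

Lemma kuhn_shift_inj : injective kuhn_shift.
Proof.
move=> [v s] [v' s'] [] /ffunP ev /mulIg es; subst s'; congr pair.
apply/ffunP => i; move: (ev i); rewrite !ffunE /=; case: ifP => // _.
exact: ordS_inj.
Qed.

Lemma kuhn_face_shift v s : c (kuhn_face v s ord0) =
   c (kuhn_face (kuhn_shift (v, s)).1 (kuhn_shift (v, s)).2 ord_max).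
Proof.
pose i := (s^-1 ord0)%g.
have si : s i = ord0 by rewrite permKV.
(* Here [ordS] wraps around: the two faces differ, but they lie on the opposite sides [K] and 0 of
   direction [i], where [c] vanishes. *)
have [vi|vi] := eqVneq (v i : nat) k.
  rewrite (@c_side _ i); last first.
    by right=> l; rewrite !ffunE si vi lift0 addn1.
  rewrite (@c_side _ i) //; left=> l; rewrite !ffunE permM lift_max si eqxx kuhn_cycE eqxx /=.
  rewrite vi modnn add0n.
  by rewrite ltnNge -ltnS ltn_ord.
congr c; apply/ffunP => l; rewrite !ffunE; apply/ffunP => j; rewrite !ffunE.
rewrite permM kuhn_cycE lift_max lift0; have [sj|sj] := eqVneq (s j) ord0.
  have -> : j = i by rewrite /i -sj permK.
  rewrite si /= modn_small; last first.
    by rewrite ltnS ltn_neqAle vi -ltnS ltn_ord.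
  by rewrite [(n < l)%N]ltnNge -ltnS ltn_ord addn0 addn1.
by rewrite -ltnS prednK ?lt0n.
Qed.

(** Inner faces cancel within their cell; first faces cancel against last faces through
    [kuhn_shift], since the cycle has sign $(-1)^n$ and the last face carries $(-1)^{n+1}$. *)
Lemma kuhn_stokes :
  \sum_(v : {ffun 'I_N -> 'I_K}) \sum_(s : 'S_N) (-1) ^+ s *
    \sum_(m < N.+1) (-1) ^+ m * c (kuhn_face v s m) = 0.
Proof.
pose F (m : 'I_N.+1) (v : {ffun 'I_N -> 'I_K}) (s : 'S_N) : int :=
  (-1) ^+ m * ((-1) ^+ s * c (kuhn_face v s m)).
transitivity (\sum_(m < N.+1) \sum_v \sum_s F m v s).
  rewrite [RHS]exchange_big /=; apply: eq_bigr => v _.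
  rewrite [RHS]exchange_big /=; apply: eq_bigr => s _.
  by rewrite mulr_sumr; apply: eq_bigr => m _; rewrite /F mulrCA.
rewrite (bigD1 ord0) //= (bigD1 ord_max) //= addrA [X in _ + X]big1 ?addr0; last first.
  move=> m /andP[m0 mN]; apply: big1 => v _; rewrite -mulr_sumr.
  by rewrite sum_inner_face ?mulr0.
rewrite !pair_big /= [X in _ + X](reindex_inj kuhn_shift_inj) /= -big_split /=.
apply: big1 => -[v s] _; rewrite /F kuhn_face_shift expr0 mul1r /=.
rewrite odd_permM signr_addb mulrA mulrA -mulrDl.
suff -> : (-1) ^+ s + (-1) ^+ N * (-1) ^+ s * (-1) ^+ kuhn_cyc = 0 :> int by rewrite mul0r.
rewrite /kuhn_cyc odd_lift_perm odd_perm1 addbF /= signr_odd mulrAC exprS mulN1r mulNr -expr2.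
by rewrite sqrr_sign mulN1r addrN.
Qed.

End Stokes.

(** * The signed volume of a labelling *)

Definition kuhn_row (f : 'I_N -> {ffun 'I_N -> nat} -> int) (i : 'I_N.+1) x : int :=
  if unlift ord0 i is Some j then f j x else 1.

Definition kuhn_mx f v s : 'M[int]_N.+1 :=
  \matrix_(i, m) kuhn_row f i (kuhn_vertex v s m).

Definition kuhn_vol f : int :=
  \sum_(v : {ffun 'I_N -> 'I_K}) \sum_(s : 'S_N) (-1) ^+ s * \det (kuhn_mx f v s).

(** A primitive for the Stokes formula: it depends on the face alone and has the determinant as its
    alternating sum over faces, up to sign. *)
Definition kuhn_cone f (j : 'I_N) (w : {ffun 'I_N -> {ffun 'I_N -> nat}}) : int :=
  (\sum_l f j (w l)) *
  \det (\matrix_(a < N, l < N) kuhn_row f (lift (lift ord0 j) a) (w l)).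

(** Laplace expansion along the row of [f j] weights each minor with the label of the omitted
    vertex, which the face does not see. That label is the total over the simplex minus the sum over
    the face, and the total drops out because the alternating sum of the minors is zero. *)
Lemma det_kuhn_mx f j v s : \det (kuhn_mx f v s) =
  - (-1) ^+ (lift ord0 j) * \sum_(m < N.+1) (-1) ^+ m * kuhn_cone f j (kuhn_face v s m).
Proof.
pose i0 := lift ord0 j; pose u (m : 'I_N.+1) := f j (kuhn_vertex v s m).
pose A := kuhn_mx f v s; pose D m := \det (row' i0 (col' m A)).
have coneE m : kuhn_cone f j (kuhn_face v s m) = (\sum_m' u m' - u m) * D m.
  congr (_ * _).
    rewrite (bigD1_ord m) //= [X in X - _]addrC addrK; apply: eq_bigr => l _.
    by rewrite ffunE.
  by congr (\det _); apply/matrixP => a l; rewrite !mxE ffunE.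
have detA : \det A = (-1) ^+ i0 * \sum_(m < N.+1) (-1) ^+ m * (u m * D m).
  rewrite (expand_det_row _ i0) mulr_sumr; apply: eq_bigr => m _.
  have -> : A i0 m = u m by rewrite mxE /kuhn_row liftK.
  by rewrite /cofactor exprD -/(D m) mulrCA -mulrA.
(* Up to sign this sum is the determinant with the row of [f j] replaced by ones, which repeats row
   0. *)
have D0 : \sum_(m < N.+1) (-1) ^+ m * D m = 0.
  pose B : 'M[int]_N.+1 := \matrix_(i, m) if i == i0 then 1 else A i m.
  have : \det B = 0.
    apply: (@determinant_alternate _ _ _ ord0 i0); first exact: neq_lift.
    by move=> m; rewrite !mxE eqxx (negbTE (neq_lift _ _)) /kuhn_row unlift_none.
  rewrite (expand_det_row _ i0) => E.
  have {}E : (-1) ^+ i0 * \sum_(m < N.+1) (-1) ^+ m * D m = 0.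
    rewrite -[RHS]E mulr_sumr; apply: eq_bigr => m _.
    rewrite mxE eqxx mul1r /cofactor exprD -mulrA; congr (_ * (_ * \det _)).
    by apply/matrixP => a l; rewrite !mxE eq_sym (negbTE (neq_lift _ _)).
  by move/eqP: E; rewrite mulf_eq0 signr_eq0 => /eqP.
rewrite -/A -/i0 detA mulNr -mulrN -sumrN; congr (_ * _).
under [RHS]eq_bigr do rewrite coneE mulrBl mulrBr opprB.
rewrite sumrB [X in _ - X](_ : _ = 0) ?subr0 //.
transitivity (\sum_(m < N.+1) (\sum_m' u m') * ((-1) ^+ m * D m)).
  by apply: eq_bigr => m _; rewrite mulrCA.
by rewrite -mulr_sumr D0 mulr0.
Qed.

Definition side_cond (f : 'I_N -> {ffun 'I_N -> nat} -> int) i :=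
  forall x : {ffun 'I_N -> nat}, (x i = 0%N -> f i x = 0) /\ (x i = K -> f i x = 1).

(** By [kuhn_stokes] it suffices that the cone vanishes on the sides. In direction [j] its first
    factor is zero. In a direction [i != j] its matrix has a zero row on side 0, and on side [K] a
    row of ones equal to its top row. *)
Lemma kuhn_vol_eq0 f j : (forall i, i != j -> side_cond f i) ->
  (forall x : {ffun 'I_N -> nat}, x j = 0%N \/ x j = K -> f j x = 0) -> kuhn_vol f = 0.
Proof.
move=> fi fj; rewrite /kuhn_vol.
transitivity (- (-1) ^+ (lift ord0 j) *
   (\sum_(v : {ffun 'I_N -> 'I_K}) \sum_(s : 'S_N) (-1) ^+ s *
     \sum_(m < N.+1) (-1) ^+ m * kuhn_cone f j (kuhn_face v s m))).
  rewrite mulr_sumr; apply: eq_bigr => v _; rewrite mulr_sumr; apply: eq_bigr => s _.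
  by rewrite (det_kuhn_mx f j) mulrCA.
rewrite kuhn_stokes ?mulr0 // => w i wi; rewrite /kuhn_cone.
have [eij|ij] := eqVneq i j.
  rewrite big1 ?mul0r // => l _; apply: fj.
  by rewrite -eij; case: wi => wi; [left | right]; exact: wi.
set B := \matrix_(_, _) _.
suff -> : \det B = 0 by rewrite mulr0.
have [a ai] : {a | lift ord0 i = lift (lift ord0 j) a}.
  have := @unlift_some _ (lift ord0 j) (lift ord0 i).
  case; first by rewrite (inj_eq lift_inj) eq_sym.
  by move=> a -> _; exists a.
have Ba l : B a l = f i (w l) by rewrite mxE -ai /kuhn_row liftK.
case: wi => wi.
  rewrite (expand_det_row _ a) big1 // => l _; rewrite Ba.
  by rewrite (fi i ij (w l)).1 ?mul0r //; exact: wi.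
have [b b0] : {b | ord0 = lift (lift ord0 j) b}.
  have [|b e _] := @unlift_some _ (lift ord0 j) ord0; last by exists b.
  by rewrite eq_sym neq_lift.
apply: (@determinant_alternate _ _ _ a b).
  apply: contraTneq (neq_lift ord0 i) => ab.
  by rewrite ai ab -b0 eqxx.
move=> l; rewrite Ba (fi i ij (w l)).2 ?mxE -?b0; last exact: wi.
by rewrite /kuhn_row unlift_none.
Qed.

(** The determinant is linear in row [j], and [f j - g j] vanishes on both sides of direction [j],
    so [kuhn_vol_eq0] removes the difference. *)
Lemma kuhn_vol_change f g j : (forall i, i != j -> f i = g i) ->
  (forall i, side_cond f i) -> (forall i, side_cond g i) -> kuhn_vol f = kuhn_vol g.
Proof.
move=> fg sf sg.
pose h i x := if i == j then f j x - g j x else f i x.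
have fgh v s : \det (kuhn_mx f v s) = \det (kuhn_mx g v s) + \det (kuhn_mx h v s).
  rewrite (@determinant_multilinear _ _ _ (kuhn_mx g v s) (kuhn_mx h v s)
    (lift ord0 j) 1 1) ?mul1r //.
  - apply/rowP => m; rewrite !mxE !mul1r /kuhn_row liftK /h eqxx.
    by rewrite addrCA subrr addr0.
  - apply/matrixP => a m; rewrite !mxE /kuhn_row; case: unliftP => // i ai.
    by rewrite fg //; apply: contraTneq (neq_lift (lift ord0 j) a) => ij; rewrite ai ij eqxx.
  - apply/matrixP => a m; rewrite !mxE /kuhn_row; case: unliftP => // i ai.
    rewrite /h ifN //.
    by apply: contraTneq (neq_lift (lift ord0 j) a) => ij; rewrite ai ij eqxx.
have h0 : kuhn_vol h = 0.
  apply: (@kuhn_vol_eq0 _ j) => [i ij x|x].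
    by rewrite /h (negbTE ij); exact: sf.
  rewrite /h eqxx => -[] xj.
    by rewrite (sf j x).1 // (sg j x).1 // subrr.
  by rewrite (sf j x).2 // (sg j x).2 // subrr.
rewrite -[RHS]addr0 -h0 /kuhn_vol -big_split /=; apply: eq_bigr => v _.
by rewrite -big_split /=; apply: eq_bigr => s _; rewrite fgh mulrDr.
Qed.

Definition coord_pos (i : 'I_N) (x : {ffun 'I_N -> nat}) : int := (0 < x i)%N%:R.

Lemma coord_pos_side i : side_cond coord_pos i.
Proof. by move=> x; rewrite /coord_pos; split=> ->. Qed.

Lemma kuhn_vol_side f : (forall i, side_cond f i) -> kuhn_vol f = kuhn_vol coord_pos.
Proof.
move=> sf; pose g t (i : 'I_N) := if (i < t)%N then coord_pos i else f i.
have sg t i : side_cond (g t) i.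
  by move=> x; rewrite /g; case: ifP => _; [exact: coord_pos_side|exact: sf].
have step t : kuhn_vol (g t) = kuhn_vol f.
  elim: t => [|t <-]; first by congr kuhn_vol.
  have [tN|Nt] := ltnP t N.
    apply: (@kuhn_vol_change _ _ (Ordinal tN)) => // i it.
    rewrite /g ltnS leq_eqVlt; suff -> : (i == t :> nat) = false by [].
    by apply: contraNF it => /eqP e; apply/eqP/val_inj.
  congr kuhn_vol; apply/funext => i; rewrite /g.
  by rewrite !(leq_trans (ltn_ord i)) // ltnW.
rewrite -(step N); congr kuhn_vol; apply/funext => i.
by rewrite /g ltn_ord.
Qed.

(** Outside the cell at the origin some label is constantly 1 and repeats row 0. In that cell the
    identity gives a unitriangular matrix, and [s] permutes its rows, so that its sign cancels and
    every simplex contributes 1. *)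
Lemma kuhn_vol_coord_pos : kuhn_vol coord_pos = N`!%:R.
Proof.
rewrite /kuhn_vol (bigD1 [ffun=> ord0]) //= [X in _ + X]big1 ?addr0; last first.
  move=> v v0; apply: big1 => s _.
  have [i vi] : exists i, v i != ord0.
    apply/existsP; apply: contraR v0; rewrite negb_exists => /forallP H.
    by apply/eqP/ffunP => i; rewrite ffunE; apply/eqP; move: (H i); rewrite negbK.
  rewrite (@determinant_alternate _ _ _ ord0 (lift ord0 i)) ?mulr0 ?neq_lift // => m.
  rewrite !mxE /kuhn_row unlift_none liftK /coord_pos ffunE.
  by rewrite addn_gt0 lt0n -[X in X || _]/(v i != ord0) vi.
have det1 : \det (kuhn_mx coord_pos [ffun=> ord0] 1) = 1.
  rewrite -det_tr det_trig.
    apply: big1 => m _; rewrite !mxE /kuhn_row; case: unliftP => [i ->|//].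
    by rewrite /coord_pos !ffunE perm1 lift0 ltnSn.
  apply/is_trig_mxP => a b ab; rewrite !mxE /kuhn_row.
  case: unliftP ab => [i ->|-> //]; rewrite lift0 ltnS => ai.
  by rewrite /coord_pos !ffunE perm1 add0n [(i < a)%N]ltnNge ai.
transitivity (\sum_(s : 'S_N) (1 : int)); last by rewrite sumr_const card_Sn.
apply: eq_bigr => s _.
have -> : kuhn_mx coord_pos [ffun=> ord0] s =
    row_perm (lift_perm ord0 ord0 s) (kuhn_mx coord_pos [ffun=> ord0] 1).
  apply/matrixP => a m; rewrite !mxE /kuhn_row.
  case: (unliftP ord0 a) => [i ->|->]; last by rewrite lift_perm_id unlift_none.
  by rewrite lift_perm_lift liftK /coord_pos !ffunE perm1.
rewrite row_permE det_mulmx det_perm det1 mulr1 odd_lift_perm /=.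
by rewrite -expr2 sqrr_sign.
Qed.

(** The volume is nonzero, so some simplex has a nonzero determinant. On it no row of labels is zero
    and none equals the row of ones, hence each [h i] takes both values there. *)
Lemma grid_miranda (h : 'I_N -> {ffun 'I_N -> nat} -> bool) :
  (forall i (x : {ffun _ -> nat}), x i = 0%N -> ~~ h i x) ->
  (forall i (x : {ffun _ -> nat}), x i = K -> h i x) ->
  exists v : {ffun 'I_N -> 'I_K}, forall i, exists a b : {ffun 'I_N -> nat},
    [/\ forall j, (v j <= a j <= (v j).+1)%N, forall j, (v j <= b j <= (v j).+1)%N,
        h i a & ~~ h i b].
Proof.
move=> h0 hK; pose f i x : int := (h i x)%:R.
have sf i : side_cond f i.
  move=> x; rewrite /f; split=> [/h0 /negbTE ->|/hK ->] //.
have : kuhn_vol f != 0.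
  by rewrite kuhn_vol_side // kuhn_vol_coord_pos pnatr_eq0 -lt0n fact_gt0.
case: (pickP (fun p : {ffun 'I_N -> 'I_K} * 'S_N => \det (kuhn_mx f p.1 p.2) != 0)).
  move=> [v s] /= dn0 _; exists v => i.
  have vert m j : (v j <= kuhn_vertex v s m j <= (v j).+1)%N.
    by rewrite ffunE leq_addr -[(v j).+1]addn1 leq_add2l leq_b1.
  have [/existsP[m hm]|] := boolP [exists m : 'I_N.+1, h i (kuhn_vertex v s m)]; last first.
    rewrite negb_exists => /forallP H; case/negP: dn0; apply/eqP.
    rewrite (expand_det_row _ (lift ord0 i)) big1 // => m _.
    by rewrite mxE /kuhn_row liftK /f (negbTE (H m)) mul0r.
  have [/existsP[m' hm']|] := boolP [exists m : 'I_N.+1, ~~ h i (kuhn_vertex v s m)].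
    by exists (kuhn_vertex v s m), (kuhn_vertex v s m').
  rewrite negb_exists => /forallP H; case/negP: dn0; apply/eqP.
  apply: (@determinant_alternate _ _ _ ord0 (lift ord0 i)); first exact: neq_lift.
  move=> m'; rewrite !mxE /kuhn_row unlift_none liftK /f.
  by move: (H m'); rewrite negbK => ->.
move=> H; rewrite /kuhn_vol big1 ?eqxx // => v _; apply: big1 => s _.
by move: (H (v, s)) => /= /negbFE /eqP ->; rewrite mulr0.
Qed.

End GridMiranda.

Lemma poincare_miranda (R : realType) n (g : 'I_n.+1 -> 'rV[R]_n.+1 -> R) :
  (forall i, continuous (g i)) ->
  (forall i (y : 'rV_n.+1), (forall j, `|y 0 j| <= 1) -> y 0 i = -1 -> g i y <= 0) ->
  (forall i (y : 'rV_n.+1), (forall j, `|y 0 j| <= 1) -> y 0 i = 1 -> 0 < g i y) ->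
  exists2 y : 'rV_n.+1, (forall j, `|y 0 j| <= 1) & forall i, g i y = 0.
Proof.
move=> gc gm gp.
(* The truncation by [minn] keeps [pt] inside the cube: the side conditions of [grid_miranda]
   concern all [x], also those with other coordinates beyond the grid. *)
pose pt k (x : {ffun 'I_n.+1 -> nat}) : 'rV[R]_n.+1 :=
  \row_j (-1 + 2 * (minn (x j) k.+1)%:R / k.+1%:R).
have ptB k x j : `|pt k x 0 j| <= 1.
  have h1 : (minn (x j) k.+1)%:R / k.+1%:R <= 1 :> R.
    by rewrite ler_pdivrMr ?ltr0n // mul1r ler_nat geq_minr.
  have h0 : 0 <= (minn (x j) k.+1)%:R / k.+1%:R :> R by rewrite divr_ge0.
  rewrite mxE -mulrA ler_norml; move: h0 h1; set t := _ / _ => h0 h1.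
  by apply/andP; split; lra.
have cell k : exists v : {ffun 'I_n.+1 -> nat}, forall i, exists a b : 'rV[R]_n.+1,
    [/\ forall j, `|pt k v 0 j - a 0 j| <= 2 / k.+1%:R,
        forall j, `|pt k v 0 j - b 0 j| <= 2 / k.+1%:R,
        0 < g i a & g i b <= 0].
  have [i x xi|i x xi|v hv] := @grid_miranda n k (fun i x => 0 < g i (pt k x)).
  - rewrite -leNgt; apply: gm; first exact: ptB.
    by rewrite mxE xi min0n mulr0 mul0r addr0.
  - apply: gp; first exact: ptB.
    by rewrite mxE xi minnn mulfK ?pnatr_eq0 // addrC -[2]/(1 + 1) addrK.
  exists [ffun j => v j : nat] => i; have [a [b [va vb ha hb]]] := hv i.
  have near (x : {ffun 'I_n.+1 -> nat}) : (forall j, (v j <= x j <= (v j).+1)%N) ->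
      forall j, `|pt k [ffun j => v j : nat] 0 j - pt k x 0 j| <= 2 / k.+1%:R.
    move=> vx j; rewrite !mxE ffunE (minn_idPl (ltnW (ltn_ord _))).
    have /andP[v1 v2] := vx j.
    rewrite (minn_idPl (leq_trans v2 (ltn_ord _))) distrC.
    rewrite (_ : _ - _ = 2 * ((x j)%:R - (v j)%:R) / k.+1%:R); last first.
      by move: (x j)%:R (v j)%:R (k.+1%:R^-1) => p q r; ring.
    rewrite -natrB // ger0_norm ?divr_ge0 ?mulr_ge0 //.
    rewrite ler_pM2r ?invr_gt0 ?ltr0n // ler_piMr //.
    by rewrite lern1; lia.
  exists (pt k a), (pt k b); split => //; [exact: near|exact: near|].
  by rewrite leNgt.
have {cell}[v vP] := choice cell.
pose Y k := pt k (v k).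
pose Q : set 'rV[R]_n.+1 := [set y | forall j, (`[-1, 1]%classic : set R) (y ord0 j)]%classic.
have Qc : compact Q.
  by apply: (@rV_compact R n.+1 (fun=> `[-1, 1]%classic)) => j; exact: segment_compact.
have QY k : Q (Y k).
  by move=> j /=; rewrite in_itv /= -ler_norml; exact: ptB.
(* The base corners of the mixed cells cluster at some [z]; as the mesh tends to 0, every
   neighbourhood of [z] contains points of both signs for each [g i]. *)
have [z [Qz zc]] : (Q `&` cluster (Y x @[x --> \oo]) !=set0)%classic.
  by apply: Qc; exists 0%N => // k _; exact: QY.
exists z => [j|i]; first by have := Qz j; rewrite /= in_itv /= -ler_norml.
have zball (P : set 'rV[R]_n.+1) : nbhs z P -> exists a b,
    [/\ P a, P b, 0 < g i a & g i b <= 0].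
  move=> /nbhs_ballP[e /= e0 eP].
  have e2 : 0 < e / 2 by rewrite divr_gt0.
  have [k0 hk0] : exists k0, 2 / k0.+1%:R < e / 2.
    exists (Num.truncn (4 / e)); rewrite ltr_pdivrMr ?ltr0n // mulrC -ltr_pdivrMr //.
    by apply: le_lt_trans (truncnS_gt _); rewrite invf_div mulrA -natrM.
  have [y [[k /= k0k <-] yz]] : ([set Y k | k in [set k | (k0 <= k)%N]] `&`
      ball z (e / 2) !=set0)%classic.
    apply: zc; last exact: nbhsx_ballx.
    by exists k0 => // k /= k0k; exists k.
  have [a [b [va vb ha hb]]] := vP k i.
  have inb (x : 'rV[R]_n.+1) : (forall j, `|Y k 0 j - x 0 j| <= 2 / k.+1%:R) -> P x.
    move=> hx; apply: eP; split => // i' j; rewrite (ord1 i').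
    have := yz.2 0 j; rewrite /ball /= => zY.
    rewrite (le_lt_trans (ler_distD (Y k 0 j) _ _)) // [e]splitr ltrD //.
    apply: le_lt_trans (hx j) _; apply: le_lt_trans hk0.
    by rewrite ler_pM2l // lef_pV2 ?posrE ?ltr0n // ler_nat ltnS.
  by exists a, b; split => //; exact: inb.
apply/eqP; rewrite eq_le; apply/andP; split; rewrite leNgt; apply/negP => gz.
  have [|a [b [_ Pb _ gb]]] := zball (fun y => 0 < g i y).
    by move: (gc i z) => /cvgr_gt; apply.
  by move: gb; rewrite leNgt Pb.
have [|a [b [Pa _ ga _]]] := zball (fun y => g i y < 0).
  by move: (gc i z) => /cvgr_lt; apply.
by move: ga; rewrite ltNge ltW.
Qed.

(** * Sign patterns of polynomials *)

Section PolyFun.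
Variables (R : realType) (n : nat).
Local Notation V := 'rV[R]_n.

(** The index is an upper bound for the degree, not the exact degree. *)
Inductive polyfun : nat -> (V -> R) -> Prop :=
| polyfun_cst d c : polyfun d (fun=> c)
| polyfun_coord d i : polyfun d.+1 (fun v => v 0 i)
| polyfun_add d f g : polyfun d f -> polyfun d g -> polyfun d (fun v => f v + g v)
| polyfun_mul d e f g : polyfun d f -> polyfun e g ->
    polyfun (d + e) (fun v => f v * g v).

Lemma polyfun_weak d e f : (d <= e)%N -> polyfun d f -> polyfun e f.
Proof.
move=> de pf; rewrite -(subnK de).
have -> : f = (fun v => 1 * f v) by apply/funext => v; rewrite mul1r.
exact: (polyfun_mul (polyfun_cst _ 1) pf).
Qed.

Lemma polyfun_scale d c f : polyfun d f -> polyfun d (fun v => c * f v).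
Proof. by move=> pf; exact: (polyfun_mul (polyfun_cst 0 c) pf). Qed.

Lemma polyfun_sum (I : Type) (r : seq I) (P : pred I) d (F : I -> V -> R) :
  (forall i, P i -> polyfun d (F i)) -> polyfun d (fun v => \sum_(i <- r | P i) F i v).
Proof.
move=> pF; elim: r => [|i r IH].
  rewrite (_ : (fun v => _) = fun=> 0); first exact: polyfun_cst.
  by apply/funext => v; rewrite big_nil.
case: (boolP (P i)) => [Pi|/negbTE Pi]; last first.
  by rewrite (_ : (fun v => _) = fun v => \sum_(i <- r | P i) F i v) //;
    apply/funext => v; rewrite big_cons Pi.
rewrite (_ : (fun v => _) = fun v => F i v + \sum_(i <- r | P i) F i v); last first.
  by apply/funext => v; rewrite big_cons Pi.
by apply: polyfun_add IH; exact: pF.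
Qed.

Lemma polyfun_prod (I : Type) (r : seq I) (P : pred I) d (F : I -> V -> R) :
  (forall i, P i -> polyfun d (F i)) ->
  polyfun (\sum_(i <- r | P i) d) (fun v => \prod_(i <- r | P i) F i v).
Proof.
move=> pF; elim: r => [|i r IH].
  rewrite (_ : (fun v => _) = fun=> 1); first exact: polyfun_cst.
  by apply/funext => v; rewrite big_nil.
rewrite big_cons; case: (boolP (P i)) => [Pi|/negbTE Pi]; last first.
  by rewrite (_ : (fun v => _) = fun v => \prod_(i <- r | P i) F i v) //;
    apply/funext => v; rewrite big_cons Pi.
rewrite (_ : (fun v => _) = fun v => F i v * \prod_(i <- r | P i) F i v); last first.
  by apply/funext => v; rewrite big_cons Pi.
by apply: polyfun_mul IH; exact: pF.
Qed.

Lemma polyfun_continuous d f : polyfun d f -> continuous f.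
Proof.
elim=> [? c|? i|? g h _ cg _ ch|? ? g h _ cg _ ch] v.
- exact: cst_continuous.
- exact: (@coord_continuous _ _ _ 0 i).
- exact: (continuousD (cg v) (ch v)).
- exact: (continuousM (cg v) (ch v)).
Qed.

Lemma polyfun_bound d f : polyfun d f -> exists2 C : R, 0 <= C &
  forall (B : R) (v : V), 1 <= B -> (forall i, `|v 0 i| <= B) -> `|f v| <= C * B ^+ d.
Proof.
elim=> [{}d c|{}d i|{}d g h _ [C C0 hC] _ [D D0 hD]|{}d e g h _ [C C0 hC] _ [D D0 hD]].
- by exists `|c| => // B v B1 _; rewrite ler_peMr // exprn_ege1.
- exists 1 => // B v B1 /(_ i) vB; rewrite mul1r (le_trans vB) // exprS.
  by rewrite ler_peMr ?exprn_ege1 // (le_trans _ B1).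
- exists (C + D); first exact: addr_ge0.
  move=> B v B1 vB; rewrite (le_trans (ler_normD _ _)) // mulrDl.
  by rewrite lerD ?hC ?hD.
- exists (C * D); first exact: mulr_ge0.
  move=> B v B1 vB; rewrite normrM exprD mulrACA.
  by rewrite ler_pM ?hC ?hD.
Qed.

(** The partial derivative is read off from the univariate restriction to a coordinate line. Its
    degree bound stays [d], which the exponents chosen later allow for. *)
Lemma polyfun_partial d f i : polyfun d f -> exists2 g, polyfun d g &
  forall v, exists2 P : {poly R}, (forall t, f (v + t *: delta_mx 0 i) = P.[t]) &
    P^`().[0] = g v.
Proof.
elim=> [{}d c|{}d j|{}d f1 f2 _ [g1 pg1 h1] _ [g2 pg2 h2]|
   {}d e f1 f2 pf1 [g1 pg1 h1] pf2 [g2 pg2 h2]].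
- exists (fun=> 0); first exact: polyfun_cst.
  by move=> v; exists c%:P => [t|]; rewrite ?hornerC // derivC horner0.
- exists (fun=> (i == j)%:R); first exact: polyfun_cst.
  move=> v; exists ((v 0 j)%:P + (i == j)%:R *: 'X) => [t|].
    by rewrite !mxE hornerD hornerC hornerZ hornerX eqxx /= [j == i]eq_sym mulrC.
  by rewrite derivD derivC derivZ derivX !hornerE.
- exists (fun v => g1 v + g2 v); first exact: polyfun_add.
  move=> v; have [P1 e1 d1] := h1 v; have [P2 e2 d2] := h2 v.
  by exists (P1 + P2) => [t|]; rewrite ?derivD hornerD ?e1 ?e2 // d1 d2.
- exists (fun v => g1 v * f2 v + f1 v * g2 v).
    by apply: polyfun_add; exact: polyfun_mul.
  move=> v; have [P1 e1 d1] := h1 v; have [P2 e2 d2] := h2 v.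
  exists (P1 * P2) => [t|]; first by rewrite hornerM e1 e2.
  rewrite derivM hornerD !hornerM d1 d2 -e1 -e2.
  by rewrite scale0r addr0.
Qed.

Definition monom (a : 'I_n -> nat) (v : V) : R := \prod_i v 0 i ^+ a i.

(** Functions are identified with their value vectors on [Z]: if the row space of [U] contains all
    monomials up to degree [D], it contains every product of a monomial and a polynomial of total
    degree at most [D]. *)
Lemma polyfun_monom_span M (Z : 'I_M -> V) D m (U : 'M[R]_(m, M)) :
  (forall a, (\sum_i a i <= D)%N -> ((\row_s monom a (Z s))%R <= U)%MS) ->
  forall d f, polyfun d f ->
  forall a, (\sum_i a i + d <= D)%N -> ((\row_s (monom a (Z s) * f (Z s)))%R <= U)%MS.
Proof.
move=> HU.
(* The extra factor [g] lets the induction pass through products of polynomials. *)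
suff H d f : polyfun d f -> forall e g,
    (forall a, (\sum_i a i + e <= D)%N -> ((\row_s (monom a (Z s) * g (Z s)))%R <= U)%MS) ->
    forall a, (\sum_i a i + d + e <= D)%N ->
      ((\row_s (monom a (Z s) * (f (Z s) * g (Z s))))%R <= U)%MS.
  move=> d f pf a aD; have := @H d f pf 0%N (fun=> 1).
  have rE : (\row_s (monom a (Z s) * (f (Z s) * 1))) = (\row_s (monom a (Z s) * f (Z s))).
    by apply/rowP => s; rewrite !mxE mulr1.
  rewrite -rE; apply; last by rewrite addn0.
  move=> b bD; rewrite (_ : (\row_s _) = \row_s monom b (Z s)); last first.
    by apply/rowP => s; rewrite !mxE mulr1.
  by apply: HU; rewrite -(addn0 (\sum_i _)%N).
elim=> {d f} [d c|d j|d f1 f2 _ h1 _ h2|d1 d2 f1 f2 _ h1 _ h2] e g hg a aD.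
- rewrite (_ : (\row_s _) = c *: \row_s (monom a (Z s) * g (Z s))); last first.
    by apply/rowP => s; rewrite !mxE mulrCA.
  by apply/scalemx_sub/hg; apply: leq_trans aD; rewrite leq_add2r leq_addr.
- pose b i := (a i + (i == j))%N.
  rewrite (_ : (\row_s _) = \row_s (monom b (Z s) * g (Z s))); last first.
    apply/rowP => s; rewrite !mxE mulrA; congr (_ * _).
    rewrite /monom (bigD1 j) //= [in RHS](bigD1 j) //= /b eqxx exprD expr1 mulrAC.
    by congr (_ * _); apply: eq_bigr => i /negbTE ->; rewrite addn0.
  apply: hg; apply: leq_trans aD; rewrite leq_add2r /b big_split /= leq_add2l.
  by rewrite (bigD1 j) //= eqxx big1 // => i /negbTE ->.
- rewrite (_ : (\row_s _) = \row_s (monom a (Z s) * (f1 (Z s) * g (Z s))) +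
      \row_s (monom a (Z s) * (f2 (Z s) * g (Z s)))); last first.
    by apply/rowP => s; rewrite !mxE mulrDl mulrDr.
  by apply: addmx_sub; [exact: h1 aD|exact: h2 aD].
- rewrite (_ : (\row_s _) = \row_s (monom a (Z s) * (f1 (Z s) * (f2 (Z s) * g (Z s)))));
    last by apply/rowP => s; rewrite !mxE !mulrA.
  apply: (h1 (d2 + e)%N (fun v => f2 v * g v)) => [b|]; last by rewrite !addnA in aD *.
  by rewrite addnA; exact: h2.
Qed.

Lemma polyfun_lagrange M (Z : 'I_M -> V) : injective Z -> forall s,
  exists d l, polyfun d l /\ forall t, l (Z t) = (s == t)%:R.
Proof.
move=> Zi s.
have sep t : exists d l, [/\ polyfun d l, l (Z s) = 1 & t != s -> l (Z t) = 0].
  have [->|ts] := eqVneq t s.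
    by exists 0%N, (fun=> 1); split => //; exact: polyfun_cst.
  have [i hi] : exists i, Z t 0 i != Z s 0 i.
    apply/existsP; apply: contraNT ts; rewrite negb_exists => /forallP H.
    by apply/eqP/Zi/rowP => i; apply/eqP; move: (H i); rewrite negbK.
  exists 1%N, (fun v => (Z s 0 i - Z t 0 i)^-1 * (v 0 i + - Z t 0 i)); split.
  - by apply/polyfun_scale/polyfun_add; [exact: polyfun_coord|exact: polyfun_cst].
  - by rewrite mulVf // subr_eq0 eq_sym.
  - by rewrite subrr mulr0.
have [d {}sep] := choice sep; have {sep}[l sep] := choice sep.
exists (\sum_(t < M) \max_(t' < M) d t')%N, (fun v => \prod_(t < M) l t v); split.
  apply: polyfun_prod => t _; have [pl _ _] := sep t.
  by apply: polyfun_weak pl; exact: leq_bigmax.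
move=> t; have [<-|st] := eqVneq s t.
  by rewrite big1 // => t' _; have [] := sep t'.
rewrite (bigD1 t) //=; have [_ _ ->] := sep t; first by rewrite mul0r.
by rewrite eq_sym.
Qed.

(* Modulo the system every monomial reduces to one with exponents < E, and Lagrange
   interpolation shows that evaluation at the solutions is onto. *)
Lemma card_solutions M (Z : 'I_M -> V) D (r : 'I_n -> V -> R) :
  injective Z -> (forall i, polyfun D (r i)) ->
  (forall s i, Z s 0 i ^+ D.+1 = r i (Z s)) -> (M <= D.+1 ^ n)%N.
Proof.
move=> Zi pr Zr.
pose U : 'M[R]_(#|{ffun 'I_n -> 'I_D.+1}|, M) :=
  \matrix_(a, s) monom (fun i => (enum_val a : {ffun 'I_n -> 'I_D.+1}) i) (Z s).
(* Strong induction on the degree: a power $x_j^{D+1}$ inside the monomial is replaced by [r j],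
   which lowers the total degree by at least one. *)
have red d : forall a, (\sum_i a i <= d)%N -> ((\row_s monom a (Z s))%R <= U)%MS.
  elim: d {-2}d (leqnn d) => [|d' IH] d dd' a ad.
    have a0 i : a i = 0%N.
      apply/eqP; rewrite -leqn0; apply: leq_trans dd'; apply: leq_trans ad.
      by rewrite (bigD1 i) //= leq_addr.
    rewrite (_ : (\row_s _) = row (enum_rank [ffun=> ord0]) U) ?row_sub //.
    apply/rowP => s; rewrite !mxE enum_rankK; apply: eq_bigr => i _.
    by rewrite ffunE a0.
  have [/forallP aD|] := boolP [forall i, (a i < D.+1)%N].
    rewrite (_ : (\row_s _) = row (enum_rank [ffun i => Ordinal (aD i)]) U) ?row_sub //.
    by apply/rowP => s; rewrite !mxE enum_rankK; apply: eq_bigr => i _; rewrite ffunE.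
  rewrite negb_forall => /existsP[j]; rewrite -leqNgt => aj.
  pose b i := (if i == j then a j - D.+1 else a i)%N.
  have ab : (\sum_i a i = \sum_i b i + D.+1)%N.
    rewrite (bigD1 j) //= [in RHS](bigD1 j) //= /b eqxx addnAC subnK //.
    by congr (_ + _)%N; apply: eq_bigr => i /negbTE ->.
  rewrite (_ : (\row_s _) = \row_s (monom b (Z s) * r j (Z s))); last first.
    apply/rowP => s; rewrite !mxE -Zr /monom (bigD1 j) //= [in RHS](bigD1 j) //=.
    rewrite /b eqxx mulrAC -exprD subnK //.
    by congr (_ * _); apply: eq_bigr => i /negbTE ->.
  apply: (@polyfun_monom_span M Z d.-1 _ U _ _ _ (pr j)).
    by apply: IH; rewrite -ltnS; case: (d) dd' {ad}.
  by move: ad; rewrite ab; case: (d) => [|d1]; rewrite addnS.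
(* The Lagrange polynomials yield all unit vectors, so [M] is at most the rank of [U], hence at most
   its number of rows. *)
have full : (1%:M <= U)%MS.
  apply/row_subP => s.
  have [d [l [pl lZ]]] := polyfun_lagrange Zi s.
  have := @polyfun_monom_span M Z d _ U (red d) _ _ pl (fun=> 0%N).
  rewrite big1 // => /(_ (leqnn d)).
  rewrite (_ : (\row_s _) = row s 1%:M) //; apply/rowP => t; rewrite !mxE lZ.
  by rewrite /monom big1 ?mul1r.
have := mxrankS full; rewrite mxrank1 => /leq_trans; apply.
apply: leq_trans (rank_leq_row _) _.
by rewrite card_ffun !card_ord.
Qed.

End PolyFun.

(** * Counting sign cells by critical points *)

Lemma finite_pos_lb (R : realType) (J : finType) (a : J -> R) :
  (forall s, 0 < a s) -> exists2 e : R, 0 < e & forall s, e <= a s.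
Proof.
move=> a0; have S0 : 0 <= \sum_s (a s)^-1.
  by apply: sumr_ge0 => s _; rewrite invr_ge0 ltW.
exists (1 + \sum_s (a s)^-1)^-1; first by rewrite invr_gt0 ltr_pwDl.
move=> s; rewrite invf_ple ?posrE ?a0 ?ltr_pwDl // (bigD1 s) //=.
rewrite addrCA lerDl addr_ge0 //; apply: sumr_ge0 => t _.
by rewrite invr_ge0 ltW.
Qed.

Definition sign_pattern (R : realType) (X : Type) (I : finType) (p : I -> X -> R) (v : X)
  : {ffun I -> bool} := [ffun i => 0 < p i v].

Section SignPatterns.
Variables (R : realType) (n : nat) (I : finType) (d : nat).
Local Notation V := 'rV[R]_n.
Variable p : I -> V -> R.
Hypothesis pp : forall i, polyfun d (p i).

Let D := (#|I| * (d + d))%N.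
Let q v := \prod_i (p i v * p i v).
Let S (v : V) := \sum_j v 0 j ^+ D.+2.

Let q_poly : polyfun D q.
Proof.
rewrite /D -sum1_card big_distrl /=; under eq_bigr do rewrite mul1n.
by apply: polyfun_prod => i _; apply: polyfun_mul; exact: pp.
Qed.

Let evenD : ~~ odd D.+2.
Proof. by rewrite /= negbK /D oddM addnn odd_double andbF. Qed.

Let S_ge0 v : 0 <= S v.
Proof. by apply: sumr_ge0 => j _; exact: exprn_even_ge0. Qed.

Let S_cont : continuous S.
Proof.
apply: (@polyfun_continuous _ _ (D.+2 * 1)); apply: polyfun_sum => j _.
elim: D.+2 => [|k IH].
  rewrite (_ : (fun v => _) = fun=> 1); first exact: polyfun_cst.
  by apply/funext => v; rewrite expr0.
rewrite (_ : (fun v => _) = fun v : V => v 0 j * v 0 j ^+ k); last first.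
  by apply/funext => v; rewrite exprS.
by rewrite mulSn; apply: polyfun_mul IH; exact: polyfun_coord.
Qed.

(* Maximize [q - eta S] over the closed sign cell of [x0]: [q] vanishes on the walls of
   the cell and [S] dominates far away, so the maximizer is a critical point inside. *)
Lemma sign_cell_critical (g : 'I_n -> V -> R) eta x0 :
  (forall j v, exists2 P : {poly R}, (forall t, q (v + t *: delta_mx 0 j) = P.[t]) &
    P^`().[0] = g j v) ->
  0 < eta -> eta * S x0 < q x0 ->
  exists z, (forall i, (0 < p i z) = (0 < p i x0)) /\
    forall j, g j z = eta * D.+2%:R * z 0 j ^+ D.+1.
Proof.
move=> gP eta0 qx0.
have [C C0 qC] := polyfun_bound q_poly.
(* The sum puts [x0] into the box; [C / eta] and 1 make $C B^D \le \eta B^{D+2}$, so that [G] is not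
   positive on the boundary of the box. *)
pose B := 1 + \sum_j `|x0 0 j| + C / eta.
have Ce0 : 0 <= C / eta by rewrite divr_ge0 // ltW.
have sx0 : 0 <= \sum_j `|x0 0 j| by apply: sumr_ge0.
have B1 : 1 <= B by rewrite /B -addrA lerDl addr_ge0.
have B0 : 0 <= B by exact: le_trans B1.
pose sg i : R := if 0 < p i x0 then 1 else -1.
pose G v := q v - eta * S v.
pose K : set V := ([set v : V | forall j, `[- B, B]%classic (v ord0 j)] `&`
   \bigcap_(i in [set: I]) (fun v => sg i * p i v) @^-1` [set r | 0 <= r])%classic.
have Kcomp : compact K.
  apply: compact_closedI.
    by apply: (@rV_compact _ _ (fun=> `[- B, B]%classic)) => j; exact: segment_compact.
  apply: closed_bigI => i _; apply: closed_comp; last exact: closed_ge.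
  move=> v _; apply: (@polyfun_continuous _ _ d); exact/polyfun_scale.
have Kx0 : K x0.
  split => [j|i _] /=.
    rewrite in_itv /= -ler_norml /B (bigD1 j) //=.
    have : 0 <= \sum_(i < n | i != j) `|x0 0 i| by apply: sumr_ge0.
    by move: Ce0; lra.
  rewrite /sg; case: ltP => px0; first by rewrite mul1r ltW.
  by rewrite mulN1r oppr_ge0.
have Gcont : continuous G.
  move=> v; apply: continuousB; first exact: (polyfun_continuous q_poly).
  by apply: continuousM; [exact: cst_continuous|exact: S_cont].
have [z /set_mem [zB zs] zmax] := EVT_max_rV (ex_intro _ x0 Kx0) Kcomp
  (continuous_subspaceT Gcont).
have Gz : 0 < G z.
  by apply: lt_le_trans (zmax x0 (mem_set Kx0)); rewrite subr_gt0.
have qz : 0 < q z.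
  by apply: lt_le_trans Gz _; rewrite gerBl mulr_ge0 // ltW.
have pz i : 0 < sg i * p i z.
  rewrite lt_neqAle (zs i Logic.I) andbT eq_sym; apply: contraTneq qz => pz0.
  rewrite /q (bigD1 i) //=; suff -> : p i z = 0 by rewrite !mul0r ltxx.
  apply/eqP; move/eqP: pz0; rewrite mulf_eq0 /sg; case: ifP => _.
    by rewrite oner_eq0.
  by rewrite oppr_eq0 oner_eq0.
have zB' j : `|z 0 j| < B.
  rewrite lt_neqAle andbC; apply/andP; split.
    by move: (zB j); rewrite /= in_itv /= -ler_norml.
  apply: contraTneq Gz => zj; rewrite -leNgt subr_le0.
  apply: (@le_trans _ _ (C * B ^+ D)).
    apply: le_trans (ler_norm _) (qC _ _ B1 _) => l.
    by move: (zB l); rewrite /= in_itv /= -ler_norml.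
  apply: (@le_trans _ _ (eta * B ^+ D.+2)); last first.
    rewrite ler_pM2l // /S (bigD1 j) //= -zj -normrX ger0_norm ?exprn_even_ge0 //.
    by rewrite lerDl; apply: sumr_ge0 => l _; exact: exprn_even_ge0.
  rewrite exprS exprS !mulrA; apply: ler_wpM2r; first exact: exprn_ge0.
  have CB : C <= eta * B.
    by rewrite mulrC -ler_pdivrMr // /B lerDr addr_ge0.
  by rewrite (le_trans CB) // ler_peMr // mulr_ge0 // ltW.
exists z; split => [i|j].
  move: (pz i); rewrite /sg; case: (ltP 0 (p i x0)) => px0; first by rewrite mul1r => ->.
  by rewrite mulN1r oppr_gt0 => pz0; apply/negbTE; rewrite -leNgt ltW.
have [P Pq <-] := gP j z.
pose T : {poly R} := (\sum_(l | l != j) z 0 l ^+ D.+2)%:P + ('X + (z 0 j)%:P) ^+ D.+2.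
pose Q := P - eta *: T.
have GQ t : G (z + t *: delta_mx 0 j) = Q.[t].
  rewrite /G Pq /Q hornerD hornerN hornerZ; congr (_ - _ * _).
  rewrite /S (bigD1 j) //= /T !hornerE !mxE !eqxx mulr1 addrC [t + _]addrC; congr (_ + _).
  by apply: eq_bigr => l lj; rewrite !mxE (negbTE lj) andbF mulr0 addr0.
(* The maximizer satisfies all constraints strictly, so a short segment through it in direction [j]
   stays in [K] and the univariate [Q] has a local maximum at 0. *)
have Knear : \forall t \near (0 : R), K (z + t *: delta_mx 0 j).
  have hnear (h : V -> R) r : continuous h -> r < h z ->
      \forall t \near (0 : R), r < h (z + t *: delta_mx 0 j).
    move=> ch rh; apply: (@cvgr_gt _ _ (nbhs (0 : R)) _ _ (h (z + 0 *: delta_mx 0 j))).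
      apply: (@continuous_comp _ _ _ (fun t : R => z + t *: delta_mx 0 j : V) h).
        by apply: continuousD; [exact: cst_continuous|exact: continuousZr_tmp].
      exact: ch.
    by rewrite scale0r addr0.
  have nA : \forall t \near (0 : R), forall i, 0 < sg i * p i (z + t *: delta_mx 0 j).
    apply: (@filter_forall _ _ (fun i (t : R) =>
      0 < sg i * p i (z + t *: delta_mx 0 j)) (nbhs (0 : R)) _) => i.
    apply: (hnear (fun v => sg i * p i v)) (pz i).
    by apply: (@polyfun_continuous _ _ d); exact/polyfun_scale.
  have nB : \forall t \near (0 : R), forall l, - B < (z + t *: delta_mx 0 j) 0 l.
    apply: (@filter_forall _ _ (fun l (t : R) =>
      - B < (z + t *: delta_mx 0 j) 0 l) (nbhs (0 : R)) _) => l.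
    apply: (hnear (fun v : V => v 0 l)).
      exact: coord_continuous.
    by have := zB' l; rewrite ltr_norml => /andP[].
  have nC : \forall t \near (0 : R), forall l, - B < - (z + t *: delta_mx 0 j) 0 l.
    apply: (@filter_forall _ _ (fun l (t : R) =>
      - B < - (z + t *: delta_mx 0 j) 0 l) (nbhs (0 : R)) _) => l.
    apply: (hnear (fun v : V => - v 0 l)).
      by move=> v; apply: continuousN; exact: coord_continuous.
    by have := zB' l; rewrite ltr_norml ltrN2 => /andP[].
  apply: filterS3 nA nB nC => t hA hB hC; split => [l|i _] /=; last exact: ltW.
  by rewrite in_itv /= ltW ?hB // ltW // -ltrN2 hC.
have Q0 : Q^`().[0] = 0.
  have [e /= e0 He] := Knear.
  have : is_derive (0 : R) 1 (horner Q) 0.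
    apply: (@derive1_at_max _ _ (- e) e) => [|t _||t te].
    - by rewrite ge0_cp // ltW.
    - exact: derivable_horner.
    - by rewrite in_itv /= oppr_lt0 e0.
    - rewrite -!GQ; rewrite [X in _ <= G X](_ : _ = z); last by rewrite scale0r addr0.
      apply/zmax/mem_set/He; rewrite /= sub0r normrN.
      by move: te; rewrite in_itv /= -ltr_norml.
  by rewrite derivE derive1E => h; exact: derive_val.
move: Q0; rewrite /Q derivB derivZ hornerD hornerN hornerZ => /eqP.
rewrite subr_eq0 => /eqP ->; rewrite -mulrA; congr (_ * _).
rewrite /T derivD derivC add0r deriv_exp derivD derivX derivC addr0 mul1r.
by rewrite hornerMn horner_exp !hornerE mulr_natl.
Qed.

(** One [eta] serves all the points [x s]. Each pattern has a critical point in its own cell; these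
    points are distinct and solve a system as in [card_solutions]. *)
Lemma card_strict_sign_patterns (J : finType) (x : J -> V) (A : {set J}) :
  (forall i s, p i (x s) != 0) ->
  (#|(fun s => sign_pattern p (x s)) @: A| <= D.+1 ^ n)%N.
Proof.
move=> px0.
have /choice[g gP] (j : 'I_n) : exists g, polyfun D g /\ forall v,
    exists2 P : {poly R}, (forall t, q (v + t *: delta_mx 0 j) = P.[t]) & P^`().[0] = g v.
  by have [g] := polyfun_partial j q_poly; exists g.
have qx0 s : 0 < q (x s).
  by apply: prodr_gt0 => i _; rewrite -expr2 exprn_even_gt0 ?px0.
have [eta eta0 etaP] : exists2 eta : R, 0 < eta & forall s, eta <= q (x s) / (1 + S (x s)).
  by apply: finite_pos_lb => s; rewrite divr_gt0 // ltr_pwDl.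
set Q := (_ @: A)%SET.
have cell (m : 'I_#|Q|) : exists z, (forall i, (0 < p i z) = enum_val m i) /\
    forall j, g j z = eta * D.+2%:R * z 0 j ^+ D.+1.
  have /imsetP[s _ ->] := enum_valP m.
  have [j v|||z [zs zg]] := @sign_cell_critical g eta (x s); first exact: (gP j).2.
  - exact: eta0.
  - have S1 : 0 < 1 + S (x s) by rewrite ltr_pwDl.
    apply: (@lt_le_trans _ _ (eta * (1 + S (x s)))); first by rewrite ltr_pM2l // ltrDr.
    by rewrite -ler_pdivlMr.
  - by exists z; split=> // i; rewrite zs ffunE.
have {cell}[Z ZP] := choice cell.
apply: (@card_solutions _ _ _ Z D (fun j v => (eta * D.+2%:R)^-1 * g j v)).
- move=> m m' Zm; apply/enum_val_inj/ffunP => i.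
  by rewrite -(ZP m).1 -(ZP m').1 Zm.
- by move=> j; apply: polyfun_scale; exact: (gP j).1.
- move=> m j; rewrite (ZP m).2 mulKf // mulf_neq0 ?pnatr_eq0 //.
  exact: lt0r_neq0.
Qed.

End SignPatterns.

(** Subtracting [e / 2], with [e] below all positive values that occur, makes zero values negative
    and keeps all patterns, which reduces to the strict case. *)
Lemma card_sign_patterns (R : realType) (n : nat) (I J : finType) (d : nat)
    (p : I -> 'rV[R]_n -> R) (x : J -> 'rV[R]_n) (A : {set J}) :
  (forall i, polyfun d (p i)) ->
  (#|(fun s => sign_pattern p (x s)) @: A| <= (#|I| * (d + d)).+1 ^ n)%N.
Proof.
move=> pp.
have [e e0 eP] : exists2 e : R, 0 < e & forall ij : I * J,
    e <= if 0 < p ij.1 (x ij.2) then p ij.1 (x ij.2) else 1.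
  by apply: finite_pos_lb => ij; case: ifP.
have p'E i s : (0 < p i (x s) - e / 2) = (0 < p i (x s)) /\ p i (x s) - e / 2 != 0.
  have := eP (i, s); rewrite /=; case: ltP => [p0 ep|p0 _].
    by have : 0 < p i (x s) - e / 2 by [lra]; move=> /[dup] /lt0r_neq0 -> ->.
  have h : p i (x s) - e / 2 < 0 by lra.
  by rewrite (ltr0_neq0 h); split => //; apply/negbTE; rewrite -leNgt ltW.
rewrite (_ : (fun s => _) =
  fun s => sign_pattern (fun i v => p i v + (- (e / 2))) (x s)); last first.
  by apply/funext => s; apply/ffunP => i; rewrite !ffunE (p'E i s).1.
apply: (@card_strict_sign_patterns _ _ _ d (fun i v => p i v + (- (e / 2)))).
  by move=> i; apply: polyfun_add; [exact: pp|exact: polyfun_cst].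
by move=> i s; exact: (p'E i s).2.
Qed.

(** * Sign patterns of networks *)

(** [B] is a largest fibre of [f] on [A]. *)
Lemma pigeonhole_fiber (S F : finType) (f : S -> F) (A : {set S}) :
  exists2 B : {set S}, B \subset A & {in B &, forall s t, f s = f t} /\
    (#|A| <= #|f @: A| * #|B|)%N.
Proof.
have [->|[s0 s0A]] := set_0Vmem A.
  by exists finset.set0; rewrite ?cards0 ?sub0set //; split => // s t; rewrite inE.
pose fib y := [set s in A | f s == y]%SET.
have F0 : (0 < #|F|)%N by apply/fintype.card_gt0P; exists (f s0).
have [y ymax] := bigop.eq_bigmax (fun y => #|fib y|) F0.
exists (fib y); first by apply/fintype.subsetP => s; rewrite inE => /andP[].
split; first by move=> s t; rewrite !inE => /andP[_ /eqP ->] /andP[_ /eqP ->].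
rewrite -[X in (X <= _)%N]sum1_card (partition_big_imset f) /= -sum_nat_const.
apply: leq_sum => z _; rewrite -ymax; apply: leq_trans (bigop.leq_bigmax z).
rewrite sum1_card; apply/subset_leq_card/fintype.subsetP => s.
by rewrite !inE.
Qed.

Lemma sum_option (T : finType) (F : option T -> nat) :
  (\sum_a F a = F None + \sum_t F (Some t))%N.
Proof.
rewrite (bigD1 None) //= (reindex_omap Some id) /=; last by case.
by congr (_ + _)%N; apply: eq_bigl => t; rewrite eqxx.
Qed.

Section NetPolynomials.
Variables (R : realType) (nu : nat) (A : arch nu).

Definition widx : finType := (option 'I_(nh A) * option ('I_nu + 'I_(nh A)))%type.

(* [None] in the first component is the output unit, in the second one the bias. *)
Definition wused (t : widx) : bool :=
  match t with
  | (_, None) => true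
  | (Some u, Some (inl i)) => i \in in_i A u
  | (Some u, Some (inr v)) => v \in in_h A u
  | (None, Some (inl i)) => i \in out_i A
  | (None, Some (inr v)) => v \in out_h A
  end.

Definition wval (th : weights R nu (nh A)) (t : widx) : R :=
  match t with
  | (Some u, Some (inl i)) => wi th u i
  | (Some u, Some (inr v)) => wh th u v
  | (Some u, None) => bh th u
  | (None, Some (inl i)) => woi th i
  | (None, Some (inr v)) => woh th v
  | (None, None) => bo th
  end.

(** Only connections present in the architecture become variables, which keeps their number below
    [nweights A]. *)
Definition pidx : finType := {t : widx | wused t}.

Definition encode (th : weights R nu (nh A)) : 'rV[R]_#|pidx| :=
  \row_k wval th (val (enum_val k)).

Definition wread (v : 'rV[R]_#|pidx|) (t : widx) : R :=
  if insub t is Some j then v 0 (enum_rank (j : pidx)) else 0.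

Definition decode (v : 'rV[R]_#|pidx|) : weights R nu (nh A) :=
  Weights (fun u i => wread v (Some u, Some (inl i)))
          (fun u w => wread v (Some u, Some (inr w)))
          (fun u => wread v (Some u, None))
          (fun i => wread v (None, Some (inl i)))
          (fun w => wread v (None, Some (inr w)))
          (wread v (None, None)).

Lemma wread_encode th t : wused t -> wread (encode th) t = wval th t.
Proof. by move=> ut; rewrite /wread insubT mxE enum_rankK. Qed.

Lemma net_decode th x : net (decode (encode th)) x = net th x.
Proof.
have hv : hidden_vals (decode (encode th)) x = hidden_vals th x.
  rewrite /hidden_vals; elim: (depth A) => //= k ->; apply/funext => u.
  rewrite /hidden_step /= wread_encode //; congr (relu (_ + _ + _));
    by apply: eq_bigr => i ui; rewrite wread_encode.
rewrite /net hv /= wread_encode //; congr (_ + _ + _);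
  by apply: eq_bigr => i ui; rewrite wread_encode.
Qed.

Lemma card_pidx : (#|pidx| <= nweights A)%N.
Proof.
have cb a (Ai : {set 'I_nu}) (Ah : {set 'I_(nh A)}) : wused (a, None) ->
    (forall i, wused (a, Some (inl i)) = (i \in Ai)) ->
    (forall i, wused (a, Some (inr i)) = (i \in Ah)) ->
    (\sum_b wused (a, b) = 1 + (#|Ai| + #|Ah|))%N.
  move=> h0 hi hh; rewrite sum_option h0 big_sumType /=; congr (_ + (_ + _))%N.
    rewrite -sum1_card [RHS]big_mkcond /=.
    by apply: eq_bigr => i _; move: (hi i) => /= ->; case: ifP.
  rewrite -sum1_card [RHS]big_mkcond /=.
  by apply: eq_bigr => i _; move: (hh i) => /= ->; case: ifP.
have -> : #|pidx| = (\sum_a \sum_b wused (a, b))%N.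
  rewrite card_sig -sum1_card pair_big /= big_mkcond /=.
  by apply: eq_bigr => -[a b] _; rewrite unfold_in /=; case: ifP.
rewrite sum_option (cb _ (out_i A) (out_h A)) //.
under eq_bigr => u _ do rewrite (cb _ (in_i A u) (in_h A u)) //.
rewrite big_split /= sum1_card card_ord /nweights.
have E (x y z t : nat) : (1 + (x + y) + (z + t) <= t + x + y + z + 1)%N by lia.
exact: E.
Qed.

Lemma polyfun_wread t : polyfun 1 (fun v => wread v t).
Proof.
rewrite /wread; case: insubP => [j _ _|_]; last exact: polyfun_cst.
exact: polyfun_coord.
Qed.

Variables (N : nat) (X : 'I_N -> 'I_nu -> R) (S : finType) (th : S -> 'rV[R]_#|pidx|).
Let L := depth A.
Let hid k s x := iter k (hidden_step (decode (th s)) (X x)) (fun=> 0).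

Lemma polyfun_affine k (Ai : {set 'I_nu}) (Ah : {set 'I_(nh A)}) ti tv t0 x
    (H : 'I_(nh A) -> 'rV[R]_#|pidx| -> R) :
  (forall u, polyfun k (H u)) ->
  polyfun k.+1 (fun v => \sum_(i in Ai) wread v (ti i) * X x i +
    \sum_(u in Ah) wread v (tv u) * H u v + wread v t0).
Proof.
move=> pH; have w1 t : polyfun k.+1 (fun v => wread v t).
  by apply: polyfun_weak (polyfun_wread t).
apply: polyfun_add (w1 _); apply: polyfun_add; apply: polyfun_sum => i _.
  by rewrite -(addn0 k.+1); apply: polyfun_mul (w1 _) _; exact: polyfun_cst.
by rewrite -add1n; apply: polyfun_mul (pH i); exact: polyfun_wread.
Qed.

(** Bounds the sign patterns of all pre-activations at all points in one iteration; the degree bound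
    [L.+1] is taken uniformly in the iteration. *)
Let B := ((N * nh A * (L.+1 + L.+1)).+1 ^ #|pidx|)%N.

(** Each iteration keeps the largest class of weight choices with equal signs of the
    pre-activations, at the cost of a factor [B]. On that class every ReLU is either the identity or
    zero, so the next values are again polynomials, of degree one higher. *)
Lemma hidden_cells (S0 : {set S}) k : (k <= L)%N ->
  exists2 S1 : {set S}, (S1 \subset S0) && (#|S0| <= B ^ k * #|S1|)%N &
    forall x u, exists2 H, polyfun k H & {in S1, forall s, hid k s x u = H (th s)}.
Proof.
elim: k => [_|k IH kL].
  exists S0; first by rewrite subxx_hint expn0 mul1n leqnn.
  by move=> x u; exists (fun=> 0); [exact: polyfun_cst|].
have [S1 /andP[S10 cS1] hS1] := IH (ltnW kL).
have /choice[H pH] (xu : 'I_N * 'I_(nh A)) : exists H, polyfun k H /\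
    {in S1, forall s, hid k s xu.1 xu.2 = H (th s)}.
  by have [H] := hS1 xu.1 xu.2; exists H.
pose pre (xu : 'I_N * 'I_(nh A)) v :=
  \sum_(i in in_i A xu.2) wread v (Some xu.2, Some (inl i)) * X xu.1 i +
  \sum_(w in in_h A xu.2) wread v (Some xu.2, Some (inr w)) * H (xu.1, w) v +
  wread v (Some xu.2, None).
have ppre xu : polyfun k.+1 (pre xu).
  by apply: (polyfun_affine _ _ _ _ _ _ (H := fun w => H (xu.1, w))) => w; exact: (pH _).1.
have [S2 S21 [fS2 cS2]] := pigeonhole_fiber (fun s => sign_pattern pre (th s)) S1.
exists S2.
  rewrite (fintype.subset_trans S21 S10) /=; apply: leq_trans cS1 _.
  rewrite expnSr -mulnA leq_mul2l; apply/orP; right; apply: leq_trans cS2 _.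
  rewrite leq_mul2r; apply/orP; right.
  have := @card_sign_patterns R _ _ _ L.+1 pre th S1.
  rewrite card_prod !card_ord; apply => xu.
  by apply: polyfun_weak (ppre xu); exact: ltnW.
move=> x u; have [->|[s0 s0S]] := set_0Vmem S2.
  by exists (fun=> 0); [exact: polyfun_cst|move=> s; rewrite inE].
have preE s : s \in S2 -> hid k.+1 s x u = relu (pre (x, u) (th s)).
  move=> sS; rewrite /hid iterS /hidden_step /=; congr (relu (_ + _ + _)).
  apply: eq_bigr => w _; congr (_ * _); apply: ((pH (x, w)).2 s).
  exact: (fintype.subsetP S21).
have [p0|p0] := boolP (0 < pre (x, u) (th s0)).
  exists (pre (x, u)) => // s sS; rewrite preE // /relu.
  have /ffunP/(_ (x, u)) := fS2 _ _ s0S sS; rewrite !ffunE p0 => /esym ps.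
  by rewrite max_r // ltW.
exists (fun=> 0); first exact: polyfun_cst.
move=> s sS; rewrite preE // /relu.
have /ffunP/(_ (x, u)) := fS2 _ _ s0S sS; rewrite !ffunE (negbTE p0) => /esym/negbT ps.
by rewrite max_l // leNgt.
Qed.

Lemma card_net_patterns_decode (I : finType) (pt : I -> 'I_N) (c : I -> R) :
  injective (fun s => [ffun i => c i < net (decode (th s)) (X (pt i))]) ->
  (#|S| <= B ^ L * (#|I| * (L.+1 + L.+1)).+1 ^ #|pidx|)%N.
Proof.
move=> inj; have [S1 /andP[_ cS1] hS1] := @hidden_cells [set: S]%SET L (leqnn L).
rewrite -cardsT; apply: leq_trans cS1 _; rewrite leq_mul2l; apply/orP; right.
have /choice[H pH] (xu : 'I_N * 'I_(nh A)) : exists H, polyfun L H /\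
    {in S1, forall s, hid L s xu.1 xu.2 = H (th s)}.
  by have [H] := hS1 xu.1 xu.2; exists H.
pose out i v := (\sum_(j in out_i A) wread v (None, Some (inl j)) * X (pt i) j +
  \sum_(w in out_h A) wread v (None, Some (inr w)) * H (pt i, w) v +
  wread v (None, None)) + - c i.
have pout i : polyfun L.+1 (out i).
  rewrite /out; apply: polyfun_add; last exact: polyfun_cst.
  by apply: (polyfun_affine _ _ _ _ _ _ (H := fun w => H (pt i, w))) => w; exact: (pH _).1.
have outE s i : s \in S1 -> (0 < out i (th s)) = (c i < net (decode (th s)) (X (pt i))).
  move=> sS; rewrite subr_gt0; congr (_ < _ + _ + _).
  by apply: eq_bigr => w _; rewrite -((pH (pt i, w)).2 s sS).
have := @card_sign_patterns R _ _ _ L.+1 out th S1 pout.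
rewrite card_in_imset // => s t sS tS /ffunP st; apply: inj; apply/ffunP => i.
by move: (st i); rewrite !ffunE !outE.
Qed.

End NetPolynomials.

(** Several thresholds [c i] may test the same point. Their number enters only the last factor,
    since the hidden units depend on the points alone; this matters for discontinuity. *)
Lemma card_net_patterns (R : realType) nu (A : arch nu) N (X : 'I_N -> 'I_nu -> R)
    (S I : finType) (w : S -> weights R nu (nh A)) (pt : I -> 'I_N) (c : I -> R) :
  injective (fun s => [ffun i => c i < net (w s) (X (pt i))]) ->
  (#|S| <= ((N * nh A * ((depth A).+1 + (depth A).+1)).+1 ^ nweights A) ^ depth A *
           (#|I| * ((depth A).+1 + (depth A).+1)).+1 ^ nweights A)%N.
Proof.
move=> inj.
have inj' : injective (fun s => [ffun i => c i < net (decode (encode (w s))) (X (pt i))]).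
  move=> s t /ffunP st; apply: inj; apply/ffunP => i.
  by move: (st i); rewrite !ffunE !net_decode.
apply: leq_trans (card_net_patterns_decode inj') _.
have le_exp b : (b.+1 ^ #|pidx A| <= b.+1 ^ nweights A)%N by rewrite leq_pexp2l ?card_pidx.
apply: leq_mul; last exact: le_exp.
by case: (depth A) => // k; rewrite leq_exp2r ?le_exp.
Qed.

(** * Test functions and continuity of networks *)

Section TestFunctions.
Variables (R : realType) (nu : nat).
Implicit Types x : 'I_nu -> R.

Definition l1dist x y : R := \sum_i `|x i - y i|.

Lemma l1distxx x : l1dist x x = 0.
Proof. by rewrite /l1dist big1 // => i _; rewrite subrr normr0. Qed.

Lemma edistxx x : Defs.edist x x = 0.
Proof. by rewrite /Defs.edist big1 ?sqrtr0 // => i _; rewrite subrr expr0n. Qed.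

Lemma l1dist_edist x y : l1dist x y <= nu%:R * Defs.edist x y.
Proof.
rewrite mulr_natl -[X in _ *+ X]card_ord -sumr_const; apply: ler_sum => i _.
rewrite -sqrtr_sqr ler_sqrt; last by apply: sumr_ge0 => j _; exact: sqr_ge0.
by rewrite (bigD1 i) //= lerDl; apply: sumr_ge0 => j _; exact: sqr_ge0.
Qed.

Lemma l1dist_lip x x' y : `|l1dist x y - l1dist x' y| <= l1dist x x'.
Proof.
rewrite /l1dist -sumrB (le_trans (ler_norm_sum _ _ _)) //; apply: ler_sum => i _.
rewrite (le_trans (ler_dist_dist _ _)) // (_ : _ - _ = x i - x' i) //; ring.
Qed.

Variables (N : nat) (X : 'I_N -> 'I_nu -> R) (M : R).

(* The default value 1 does not interfere with the data, which are bounded by 1. *)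
Definition mcshane (y : 'I_N -> R) x : R :=
  \big[Num.min/1]_k (y k + M * l1dist x (X k)).

Lemma bigmin_dist (F G : 'I_N -> R) e : 0 <= e -> (forall k, `|F k - G k| <= e) ->
  `|\big[Num.min/1]_k F k - \big[Num.min/1]_k G k| <= e.
Proof.
move=> e0 FG; apply: (big_ind2 (fun a b => `|a - b| <= e)) => //.
  by rewrite subrr normr0.
move=> a b c d; rewrite !ler_norml => /andP[h1 h2] /andP[h3 h4].
by case: (leP a c); case: (leP b d) => *; apply/andP; split; lra.
Qed.

Hypothesis M0 : 0 <= M.

Lemma mcshane_lip y x x' : `|mcshane y x - mcshane y x'| <= M * nu%:R * Defs.edist x x'.
Proof.
apply: bigmin_dist => [|k]; first by rewrite !mulr_ge0 // sqrtr_ge0.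
rewrite opprD addrACA subrr add0r -mulrBr normrM ger0_norm // -mulrA.
apply: ler_wpM2l => //; apply: le_trans (l1dist_edist _ _); exact: l1dist_lip.
Qed.

Lemma mcshane_cont y : cont_cube (mcshane y).
Proof.
move=> x _ e e0; exists (e / (M * nu%:R + 1)).
  by rewrite divr_gt0 // ltr_wpDl // mulr_ge0.
move=> x' _; rewrite ltr_pdivlMr ?ltr_wpDl ?mulr_ge0 // => h.
apply: le_lt_trans (mcshane_lip _ _ _) _; apply: le_lt_trans h.
by rewrite mulrC ler_wpM2l ?sqrtr_ge0 // lerDl.
Qed.

Lemma mcshane_omega y r : 0 <= r -> omega (mcshane y) r <= M * nu%:R * r.
Proof.
move=> r0; apply: ge_sup.
  exists 0, (fun=> 0), (fun=> 0); split; [..|by rewrite subrr normr0].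
  - by move=> i; rewrite lexx ler01.
  - by move=> i; rewrite lexx ler01.
  - by rewrite edistxx.
move=> _ [x [x' [_ _ xx' ->]]]; apply: le_trans (mcshane_lip _ _ _) _.
by rewrite ler_wpM2l // mulr_ge0.
Qed.

(** The extension is nonexpansive in the data, so a continuous weight assignment becomes continuous
    on a finite-dimensional space of data. *)
Lemma mcshane_supnorm y y' e : 0 <= e -> (forall k, `|y k - y' k| <= e) ->
  supnorm (fun x => mcshane y x - mcshane y' x) <= e.
Proof.
move=> e0 yy; apply: ge_sup.
  exists `|mcshane y (fun=> 0) - mcshane y' (fun=> 0)|, (fun=> 0) => //.
  by move=> i; rewrite lexx ler01.
move=> _ [x _ ->]; apply: bigmin_dist => // k.
by rewrite opprD addrACA subrr addr0.
Qed.

(** Data in [-1, 1] differ by at most 2, so under this separation no other term of the minimum falls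
    below [y k]. *)
Lemma mcshane_interp y k : (forall i j, i != j -> 2 <= M * l1dist (X i) (X j)) ->
  (forall i, `|y i| <= 1) -> mcshane y (X k) = y k.
Proof.
move=> sep y1; apply/le_anti/andP; split.
  by apply: le_trans (bigmin_le _ k _) _; rewrite l1distxx mulr0 addr0.
apply: le_bigmin => [|i _]; first by have := y1 k; rewrite ler_norml => /andP[].
have [->|ik] := eqVneq i k; first by rewrite l1distxx mulr0 addr0.
have := sep k i; rewrite eq_sym => /(_ ik) sepi.
have := y1 k; have := y1 i; rewrite !ler_norml => /andP[h1 h2] /andP[h3 h4].
by lra.
Qed.

End TestFunctions.

Lemma separated_points (R : realType) nu m N : (0 < m)%N -> (N <= m ^ nu)%N ->
  exists X : 'I_N -> 'I_nu -> R, (forall k, in_cube (X k)) /\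
    forall j k, j != k -> m%:R^-1 <= l1dist (X j) (X k).
Proof.
move=> m0 Nm; have Nc : (N <= #|{ffun 'I_nu -> 'I_m}|)%N by rewrite card_ffun !card_ord.
pose e (k : 'I_N) : {ffun 'I_nu -> 'I_m} := enum_val (widen_ord Nc k).
exists (fun k i => (e k i)%:R / m%:R); split => [k i|j k jk].
  by rewrite divr_ge0 //= ler_pdivrMr ?ltr0n // mul1r ler_nat ltnW.
have [i ei] : exists i, e j i != e k i.
  apply/existsP; apply: contraNT jk; rewrite negb_exists => /forallP H.
  suff /enum_val_inj/(congr1 val) /= h : e j = e k by apply/eqP/val_inj.
  by apply/ffunP => i; apply/eqP; move: (H i); rewrite negbK.
rewrite /l1dist (bigD1 i) //= -[X in X <= _]addr0 lerD //; last exact: sumr_ge0.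
rewrite -mulrBl normrM [X in _ * X]ger0_norm ?invr_ge0 //.
rewrite ler_peMl ?invr_ge0 //.
have {}ei : (e j i : nat) != e k i by [].
have : (1 <= `|((e j i)%:Z - (e k i)%:Z)%R|) by lia.
rewrite -(ler_int R) intr_norm rmorphB /= => h.
exact: h.
Qed.

(** * Continuity of the network output in the weights and in the data *)

Section NetContinuity.
Variables (R : realType) (nu : nat) (A : arch nu) (x : 'I_nu -> R).
Local Notation V := 'rV[R]_#|pidx A|.

Lemma continuous_bigsum (T : topologicalType) (I : Type) (r : seq I) (P : pred I)
    (F : I -> T -> R) : (forall i, continuous (F i)) ->
  continuous (fun t => \sum_(i <- r | P i) F i t).
Proof.
move=> cF; elim: r => [|i r IH].
  rewrite (_ : (fun t => _) = fun=> 0); first exact: cst_continuous.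
  by apply/funext => t; rewrite big_nil.
rewrite (_ : (fun t => _) = fun t => (if P i then F i t else 0) +
    \sum_(i <- r | P i) F i t); last first.
  by apply/funext => t; rewrite big_cons; case: ifP => //; rewrite add0r.
move=> t; apply: continuousD; last exact: IH.
by case: (P i); [exact: cF|exact: cst_continuous].
Qed.

Lemma continuous_affine (Ai : {set 'I_nu}) (Ah : {set 'I_(nh A)}) ti tv t0
    (h : V -> 'I_(nh A) -> R) : (forall u, continuous (fun v => h v u)) ->
  continuous (fun v : V => \sum_(i in Ai) wread v (ti i) * x i +
    \sum_(u in Ah) wread v (tv u) * h v u + wread v t0).
Proof.
move=> ch; have cw t : continuous (fun v : V => wread v t).
  by apply: (@polyfun_continuous _ _ 1); exact: polyfun_wread.
have c1 : continuous (fun v : V => \sum_(i in Ai) wread v (ti i) * x i).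
  by apply: continuous_bigsum => i v; exact: (continuousM (cw _ v) (@cst_continuous _ _ _ v)).
have c2 : continuous (fun v : V => \sum_(u in Ah) wread v (tv u) * h v u).
  by apply: continuous_bigsum => u v; exact: (continuousM (cw _ v) (ch u v)).
by move=> v; exact: (continuousD (continuousD (c1 v) (c2 v)) (cw t0 v)).
Qed.

Lemma continuous_net_decode : continuous (fun v : V => net (decode v) x).
Proof.
have ch u : continuous (fun v : V => hidden_vals (decode v) x u).
  rewrite /hidden_vals; elim: (depth A) u => [|k IH] u; first exact: cst_continuous.
  have := @continuous_affine (in_i A u) (in_h A u) (fun i => (Some u, Some (inl i)))
    (fun w => (Some u, Some (inr w))) (Some u, None) _ IH.
  by move=> /(_ _) cpre v; exact: (continuous_max (@cst_continuous _ _ 0 v) (cpre v)).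
exact: (@continuous_affine (out_i A) (out_h A) (fun i => (None, Some (inl i)))
    (fun w => (None, Some (inr w))) (None, None) _ ch).
Qed.

Lemma weights_close_wval (t1 t2 : weights R nu (nh A)) e t :
  weights_close t1 t2 e -> wused t -> `|wval t1 t - wval t2 t| < e.
Proof.
move=> [hi hh hb [oi oh ob]]; case: t => [[u|] [[i|v]|]] //= ut.
- exact: hi. - exact: hh. - exact: oi. - exact: oh.
Qed.

Lemma continuous_assigned_net (asg : (('I_nu -> R) -> R) -> weights R nu (nh A))
    N (X : 'I_N -> 'I_nu -> R) M : 0 <= M -> assign_continuous asg ->
  continuous (fun y : 'rV[R]_N => net (asg (mcshane X M (y 0))) x).
Proof.
move=> M0 casg.
rewrite (_ : (fun y => _) =
  (fun v : V => net (decode v) x) \o (fun y : 'rV[R]_N => encode (asg (mcshane X M (y 0)))));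
  last by apply/funext => y /=; rewrite net_decode.
move=> y; apply: continuous_comp; last exact: continuous_net_decode.
apply/cvg_ballP => [|e e0]; first exact: nbhs_filter.
have [d d0 dP] := casg _ (mcshane_cont X M0 (y 0)) e e0.
apply: (proj2 (@nbhs_ballP _ _ y _)); exists (d / 2) => [|y' yy']; first by rewrite /= divr_gt0.
split => // i k; rewrite !mxE; apply: weights_close_wval; last exact: (valP (enum_val k)).
apply: dP; first exact: mcshane_cont.
apply: (@le_lt_trans _ _ (d / 2)); last by lra.
apply: mcshane_supnorm; first by lra.
by move=> j; apply: ltW; exact: yy'.2 0 j.
Qed.

End NetContinuity.

(** * Consequences of the approximation rate *)

Lemma nh_le_nweights nu (A : arch nu) : (nh A <= nweights A)%N.
Proof. by rewrite /nweights -addnA addnCA leq_addr. Qed.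

(** No layer is empty, and units from different layers are distinct. *)
Lemma depth_le_nh nu (A : arch nu) : (depth A <= nh A)%N.
Proof.
have /choice[f fP] (l : 'I_(depth A)) : exists u, lay A u = l.+1.
  by apply: lay_nonempty; rewrite ltn_ord.
have finj : injective f.
  by move=> l l' /(congr1 (lay A)); rewrite !fP => -[] /val_inj.
by rewrite -[X in (X <= _)%N]card_ord -[X in (_ <= X)%N]card_ord; exact: leq_card finj.
Qed.

Section Asymptotics.
Variable R : realType.

Lemma powRD_gt0 (x r s : R) : 0 < x -> x `^ (r + s) = x `^ r * x `^ s.
Proof. by move=> x0; rewrite powRD // (gt_eqF x0) implybT. Qed.

Lemma powR_eventually (e C : R) : 0 < e ->
  exists W0, forall W, (W0 <= W)%N -> C <= W%:R `^ e.
Proof.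
move=> e0; exists (Num.truncn (Num.max 1 C `^ e^-1)).+1 => W WW.
have C1 : 1 <= Num.max 1 C by rewrite le_max lexx.
apply: (@le_trans _ _ (Num.max 1 C)); first by rewrite le_max lexx orbT.
have {1}-> : Num.max 1 C = (Num.max 1 C `^ e^-1) `^ e.
  by rewrite -powRrM mulVf ?gt_eqF // powRr1 // (le_trans ler01).
apply: ge0_ler_powR; rewrite ?nnegrE ?powR_ge0 ?ler0n //; first exact: ltW.
by apply/ltW/(lt_le_trans (truncnS_gt _)); rewrite ler_nat.
Qed.

Lemma ln_le_powR (e : R) W : 0 < e -> (0 < W)%N -> ln W%:R <= W%:R `^ e / e.
Proof.
move=> e0 W0; rewrite ler_pdivlMr // mulrC -ln_powR; apply/ltW/ln_sublinear.
by rewrite powR_gt0 ?ltr0n.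
Qed.

Lemma truncn_half (t : R) : 1 <= t -> t / 2 <= (Num.truncn t)%:R.
Proof.
move=> t1; have := truncnS_gt t; have : 1 <= (Num.truncn t)%:R :> R.
  by rewrite ler1n truncn_gt0.
by rewrite -natr1; lra.
Qed.

Variables (nu : nat) (p : R) (eta : nat -> arch nu).
Variable asg : forall W : nat, (('I_nu -> R) -> R) -> weights R nu (nh (eta W)).
Variables a c : R.
Hypotheses (nu0 : (0 < nu)%N) (p0 : 0 < p) (a0 : 0 < a) (c0 : 0 < c).
Hypothesis etaW : forall W, (0 < W)%N -> nweights (eta W) = W.
Hypothesis rate : forall W (f : ('I_nu -> R) -> R), (0 < W)%N -> cont_cube f ->
  forall x, in_cube x -> `|f x - net (asg W f) x| <= a * omega f (c * (W%:R `^ (- p))).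

(** With Lipschitz constant [2 * m%:R * nu%:R], the error $2 a c \nu m W^{-p}$ is at most 1/2
    exactly when $m \le \kappa W^p$. *)
Let kappa : R := (4 * a * c * nu%:R)^-1.

Let kappa_gt0 : 0 < kappa.
Proof. by rewrite invr_gt0 !mulr_gt0 // ltr0n. Qed.

Lemma net_near_data W m N (X : 'I_N -> 'I_nu -> R) y k :
  (0 < W)%N -> (0 < m)%N -> m%:R <= kappa * W%:R `^ p ->
  (forall k, in_cube (X k)) -> (forall i j, i != j -> m%:R^-1 <= l1dist (X i) (X j)) ->
  (forall i, `|y i| <= 1) ->
  `|y k - net (asg W (mcshane X (2 * m%:R) y)) (X k)| <= 1 / 2.
Proof.
move=> W0 m0 mk Xc Xsep y1.
have mR : 0 < m%:R :> R by rewrite ltr0n.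
have M0 : 0 <= 2 * m%:R :> R by rewrite mulr_ge0.
have Wp : 0 < W%:R `^ p by rewrite powR_gt0 ?ltr0n.
have := rate W0 (mcshane_cont X M0 y) (Xc k).
rewrite mcshane_interp // => [h|i j ij]; last first.
  rewrite -mulrA -[X in X <= _]mulr1 ler_pM2l // mulrC -ler_pdivrMr // mul1r.
  exact: Xsep.
apply: le_trans h _.
have r0 : 0 <= c * W%:R `^ (- p) by rewrite mulr_ge0 ?powR_ge0 // ltW.
apply: le_trans (ler_wpM2l (ltW a0) (mcshane_omega _ M0 _ r0)) _.
rewrite powRN; move: mk; rewrite /kappa mulrC ler_pdivlMr ?mulr_gt0 ?ltr0n // => mk.
rewrite (_ : a * _ = (m%:R * (4 * a * c * nu%:R)) / W%:R `^ p / 2).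
  by rewrite ler_pM2r ?invr_gt0 // ler_pdivrMr // mul1r.
by field; rewrite lt0r_neq0.
Qed.

(** Data 1 and -1 with error 1/2 force the sign of the output, so all $2^N$ patterns occur at the $N
    = m^\nu$ points. The 5 absorbs the successor in $4 N W^2 + 1$; the exponent counts the [L]
    hidden stages and the output. *)
Lemma shattering_bound W m : (0 < W)%N -> (0 < m)%N -> m%:R <= kappa * W%:R `^ p ->
  (2 ^ (m ^ nu) <= (5 * m ^ nu * W ^ 2) ^ (W * (depth (eta W)).+1))%N.
Proof.
move=> W0 m0 mk; set N := (m ^ nu)%N; set L := depth (eta W).
have N0 : (0 < N)%N by rewrite expn_gt0 m0.
have [X [Xc Xsep]] := @separated_points R nu m N m0 (leqnn _).
pose y (b : {ffun 'I_N -> bool}) k : R := if b k then 1 else -1.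
have y1 b i : `|y b i| <= 1 by rewrite /y; case: ifP; rewrite ?normrN normr1.
pose w b := asg W (mcshane X (2 * m%:R) (y b)).
have := @card_net_patterns R nu (eta W) N X _ _ w id (fun=> 0).
rewrite card_ffun card_bool !card_ord etaW // -/L => /(_ _) Hc.
apply: (leq_trans (Hc _)).
  move=> b b' /ffunP bb'; apply/ffunP => k; move: (bb' k); rewrite !ffunE.
  have wb d : (0 < net (w d) (X k)) = d k.
    have := net_near_data k W0 m0 mk Xc Xsep (y1 d); rewrite -/(w d) ler_norml /y.
    by case: (d k) => /andP[h1 h2]; [|apply/negbTE; rewrite -leNgt]; lra.
  by rewrite !wb.
have nhW : (nh (eta W) <= W)%N by rewrite -[X in (_ <= X)%N](etaW W0) nh_le_nweights.
have LW : (L <= W)%N by apply: leq_trans nhW; exact: depth_le_nh.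
set b := (5 * N * W ^ 2)%N.
have W2 : (W <= W ^ 2)%N by rewrite -[X in (X <= _)%N]expn1 leq_pexp2l.
have NW : (0 < N * W ^ 2)%N by rewrite muln_gt0 N0 expn_gt0 W0.
have bE : b = (5 * (N * W ^ 2))%N by rewrite /b mulnA.
have b1 : ((N * nh (eta W) * (L.+1 + L.+1)).+1 <= b)%N.
  have : (N * nh (eta W) * (L.+1 + L.+1) <= N * W * (4 * W))%N.
    by apply: leq_mul; [rewrite leq_mul2l nhW orbT|lia].
  have -> : (N * W * (4 * W) = 4 * (N * W ^ 2))%N by rewrite -mulnn; lia.
  by rewrite bE; lia.
have b2 : ((N * (L.+1 + L.+1)).+1 <= b)%N.
  have : (N * (L.+1 + L.+1) <= N * (4 * W ^ 2))%N by rewrite leq_mul2l; lia.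
  by rewrite bE; lia.
rewrite [(W * L.+1)%N]mulnSr expnD expnM.
have mono x z e : (x <= z -> x ^ e <= z ^ e)%N by case: e => // e; rewrite leq_exp2r.
exact: leq_mul (mono _ _ _ (mono _ _ _ b1)) (mono _ _ _ b2).
Qed.

Lemma grid_size W : 1 <= kappa * W%:R `^ p -> exists m : nat,
  [/\ (0 < m)%N, m%:R <= kappa * W%:R `^ p &
    (kappa / 2) ^+ nu * W%:R `^ (p * nu%:R) <= (m ^ nu)%:R].
Proof.
set t := kappa * _ => t1; have t0 : 0 <= t by exact: le_trans t1.
exists (Num.truncn t); split; first by rewrite truncn_gt0.
  by rewrite truncn_le.
have tnu : t ^+ nu = kappa ^+ nu * W%:R `^ (p * nu%:R).
  by rewrite /t exprMn powRrM powR_mulrn ?powR_ge0.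
rewrite expr_div_n mulrAC -tnu -expr_div_n natrX lerXn2r ?nnegrE ?truncn_half //.
exact: divr_ge0.
Qed.

(** Logarithm of [shattering_bound] for the largest admissible grid. [C] absorbs the constants of
    $\ln(5 N W^2)$ once $\ln W \ge 1$, whence the threshold [expR 1]. *)
Lemma rate_depth : exists2 d : R, 0 < d & exists W0, forall W, (W0 <= W)%N ->
  d * W%:R `^ (p * nu%:R) <= W%:R * (depth (eta W)).+1%:R * ln W%:R.
Proof.
pose C : R := `|ln (5 * kappa ^+ nu)| + p * nu%:R + 2.
have C0 : 0 < C by rewrite /C ltr_wpDl // addr_ge0 // mulr_ge0 // ltW.
have l2 : 0 < ln 2 :> R by rewrite ln_gt0 // ltr1n.
exists ((kappa / 2) ^+ nu * ln 2 / C).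
  by rewrite divr_gt0 // mulr_gt0 // exprn_gt0 // divr_gt0.
have [W1 W1P] := powR_eventually (1 / kappa) p0.
have [W2 W2P] := powR_eventually (expR 1) (@ltr01 R).
exists (maxn 1 (maxn W1 W2)) => W; rewrite !geq_max => /and3P[W0 /W1P kW /W2P eW].
have WR : 0 < W%:R :> R by rewrite ltr0n.
rewrite powRr1 // in eW.
have lnW : 1 <= ln W%:R :> R by rewrite -[X in X <= _]expRK ler_ln ?posrE ?expR_gt0.
have {}kW : 1 <= kappa * W%:R `^ p by rewrite mulrC -ler_pdivrMr.
have [m [m0 mt Nlow]] := grid_size kW; set L1 := (depth (eta W)).+1.
have Nup : (m ^ nu)%:R <= kappa ^+ nu * W%:R `^ (p * nu%:R) :> R.
  rewrite powRrM powR_mulrn ?powR_ge0 // -exprMn natrX lerXn2r ?nnegrE //.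
  exact: le_trans kW.
have Npos : 0 < (m ^ nu)%:R :> R by rewrite ltr0n expn_gt0 m0.
have lnb : ln (5 * (m ^ nu)%:R * W%:R ^+ 2) <= C * ln W%:R.
  apply: (@le_trans _ _ (ln (5 * kappa ^+ nu * (W%:R `^ (p * nu%:R) * W%:R ^+ 2)))).
    rewrite ler_ln ?posrE ?mulr_gt0 ?exprn_gt0 ?powR_gt0 //.
    by rewrite mulrA ler_pM2r ?exprn_gt0 // -mulrA ler_pM2l.
  rewrite lnM ?posrE ?mulr_gt0 ?exprn_gt0 ?powR_gt0 //.
  rewrite [ln (_ `^ _ * _)]lnM ?posrE ?exprn_gt0 ?powR_gt0 // ln_powR lnXn // mulr2n /C.
  have : ln (5 * kappa ^+ nu) <= `|ln (5 * kappa ^+ nu)| * ln W%:R.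
    by apply: le_trans (ler_norm _) _; rewrite ler_peMr.
  by move: (ln (5 * _)) (ln W%:R) => q l; lra.
have := shattering_bound W0 m0 mt; rewrite -(ler_nat R) natrX => sh.
have {sh} : (m ^ nu)%:R * ln 2 <= (W * L1)%:R * (C * ln W%:R) :> R.
  apply: (@le_trans _ _ ((W * L1)%:R * ln (5 * (m ^ nu)%:R * W%:R ^+ 2))); last first.
    by rewrite ler_wpM2l.
  rewrite mulr_natl [X in _ <= X]mulr_natl -!lnXn ?mulr_gt0 ?exprn_gt0 //.
  rewrite ler_ln ?posrE ?exprn_gt0 ?mulr_gt0 //.
  by move: sh; rewrite natrX !natrM natrX.
move=> H; rewrite mulrAC ler_pdivrMr // natrM in H *.
rewrite mulrAC; apply: le_trans (_ : (m ^ nu)%:R * ln 2 <= _).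
  by rewrite ler_pM2r.
by apply: le_trans H _; rewrite [C * _]mulrC mulrA.
Qed.

Lemma assignment_discontinuous : 1 < p * nu%:R ->
  exists2 W, (0 < W)%N & ~ assign_continuous (asg W).
Proof.
rewrite -subr_gt0 => s0.
have kn : 0 < (kappa / 2) ^+ nu by rewrite exprn_gt0 // divr_gt0.
have [W1 W1P] := powR_eventually (1 / kappa) p0.
have [W2 W2P] := powR_eventually (2 / (kappa / 2) ^+ nu) s0.
pose W := maxn 1 (maxn W1 W2).
have W0 : (0 < W)%N by rewrite leq_max.
have kW : 1 <= kappa * W%:R `^ p.
  by rewrite mulrC -ler_pdivrMr // W1P // !leq_max leqnn orbT.
have [m [m0 mt Nlow]] := grid_size kW.
exists W => // casg.
have WN : (W.+1 <= m ^ nu)%N.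
  rewrite -(ler_nat R); apply: le_trans Nlow.
  rewrite -[p * _](subrK 1) powRD_gt0 ?ltr0n // powRr1 //.
  have /W2P : (W2 <= W)%N by rewrite !leq_max leqnn !orbT.
  rewrite ler_pdivrMr // [X in _ <= X -> _]mulrC => h.
  rewrite mulrA; apply: (@le_trans _ _ (2 * W%:R)); last by rewrite ler_wpM2r.
  by rewrite -natrM ler_nat mul2n -addnn -addn1 leq_add2l.
have [X [Xc Xsep]] := @separated_points R nu m W.+1 m0 WN.
pose g k (y : 'rV[R]_W.+1) := net (asg W (mcshane X (2 * m%:R) (y 0))) (X k).
have gc k : continuous (g k) by apply: continuous_assigned_net => //; rewrite mulr_ge0.
have gy k (y : 'rV[R]_W.+1) : (forall j, `|y 0 j| <= 1) -> `|y 0 k - g k y| <= 1 / 2.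
  by move=> y1; exact: net_near_data.
(* On the sides $y_k = -1$ and $y_k = 1$ the output [g k] is at most -1/2 and at least 1/2
   respectively, so Poincare-Miranda applies to [g k - z k]. *)
have hit (z : 'I_W.+1 -> R) : (forall k, 0 <= z k < 1 / 2) -> exists y, forall k, g k y = z k.
  move=> z0; have [k||k y y1 yk|y _ yz] := @poincare_miranda R W (fun k y => g k y - z k).
  - by move=> y; apply: continuousB; [exact: gc|exact: cst_continuous].
  - move=> k y y1 yk; have := gy k y y1; rewrite yk ler_norml.
    by have := z0 k => /andP[h1 h2] /andP[h3 h4]; lra.
  - have := gy k y y1; rewrite yk ler_norml.
    by have := z0 k => /andP[h1 h2] /andP[h3 h4]; lra.
  - by exists y => k; apply/eqP; rewrite -subr_eq0 yz.
set L := depth (eta W).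
pose B0 := (((W.+1 * nh (eta W) * (L.+1 + L.+1)).+1 ^ W) ^ L)%N.
pose D := (W.+1 * (L.+1 + L.+1)).+1.
(* Neither [B0] nor [D] depends on [K], so [K] can be chosen beyond the constant of the upper bound
   $B_0 D^W K^W$ for the $K^{W+1}$ targets. *)
have [K BK] : exists K, (B0 * D ^ W < K)%N by exists (B0 * D ^ W).+1.
have K0 : 0 < 2 * K%:R :> R by rewrite mulr_gt0 // ltr0n (leq_ltn_trans _ BK).
have /choice[y yP] (s : {ffun 'I_W.+1 -> 'I_K}) : exists y : 'rV[R]_W.+1,
    forall k, g k y = (s k)%:R / (2 * K%:R).
  apply: hit => k; apply/andP; split; first by rewrite divr_ge0 // ltW.
  by rewrite ltr_pdivrMr // mulrA mul1r mulVf // mul1r ltr_nat.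
have := @card_net_patterns R nu (eta W) W.+1 X {ffun 'I_W.+1 -> 'I_K}
  ('I_W.+1 * 'I_K)%type (fun s => asg W (mcshane X (2 * m%:R) (y s 0))) fst
  (fun kj => kj.2%:R / (2 * K%:R)).
rewrite card_prod card_ffun !card_ord etaW // -/L -/B0 => /(_ _) Hc.
have {}Hc : (K ^ W.+1 <= B0 * (W.+1 * K * (L.+1 + L.+1)).+1 ^ W)%N.
  (* The thresholds $j/(2K)$ recover each [s k] from the comparisons $j < s_k$. *)
  apply: Hc => s s' /ffunP ss; apply/ffunP => k; apply/val_inj/eqP.
  have cmp j : (j < s k)%N = (j < s' k)%N :> bool.
    have [jK|Kj] := ltnP j K; last first.
      by rewrite !ltnNge !(leq_trans (ltnW (ltn_ord _)) Kj).
    have := ss (k, Ordinal jK); rewrite !ffunE /= -/(g k (y s)) -/(g k (y s')) !yP.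
    by rewrite !ltr_pM2r ?invr_gt0 // !ltr_nat.
  rewrite eqn_leq; apply/andP; split; rewrite leqNgt.
    by rewrite cmp ltnn.
  by rewrite -cmp ltnn.
have KD : ((W.+1 * K * (L.+1 + L.+1)).+1 <= K * D)%N.
  rewrite /D mulnS mulnAC [X in (X < _)%N]mulnC -add1n leq_add2r.
  exact: leq_ltn_trans BK.
have : (K ^ W.+1 <= B0 * (K * D) ^ W)%N.
  by apply: leq_trans Hc _; rewrite leq_mul2l leq_exp2r // KD orbT.
rewrite expnMn mulnCA expnSr leq_pmul2l ?expn_gt0 ?(leq_ltn_trans _ BK) //.
by rewrite leqNgt BK.
Qed.

End Asymptotics.

Theorem theorem2 (R : realType) (nu : nat) (hnu : (1 <= nu)%N) :
  (forall p : R, 2 / nu%:R < p -> ~ rate_achieved nu p) /\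
  (forall p : R, 1 / nu%:R < p -> ~ rate_achieved_cont nu p) /\
  (forall p : R, 1 / nu%:R < p -> p <= 2 / nu%:R ->
     forall (eta : nat -> arch nu)
            (asg : forall W : nat, (('I_nu -> R) -> R) -> weights R nu (nh (eta W))),
       rate_ok p eta asg ->
       exists2 d : R, 0 < d & exists W0 : nat, forall W : nat, (W0 <= W)%N ->
         d * (W%:R `^ (p * nu%:R - 1)) / ln (W%:R) <= (depth (eta W))%:R).
Proof.
have nuR : 0 < nu%:R :> R by rewrite ltr0n.
split; [|split] => p.
- rewrite ltr_pdivrMr // -subr_gt0 => pnu [eta [asg [a [c [a0 c0 etaW rate]]]]].
  have p0 : 0 < p by rewrite -(pmulr_lgt0 _ nuR); lra.
  have [d d0 [W1 W1P]] := rate_depth hnu p0 a0 c0 etaW rate.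
  (* With $p\nu = 2 + 2e$ and depth at most $W$, [rate_depth] bounds $W^{2+2e}$ by a multiple of
     $W^2 \ln W$, hence of $W^{2+e}$; this fails for large [W]. *)
  pose e := (p * nu%:R - 2) / 2; have e0 : 0 < e by rewrite divr_gt0.
  have [W2 W2P] := powR_eventually (2 / e / d + 1) e0.
  pose W := maxn 1 (maxn W1 W2).
  have W0 : (0 < W)%N by rewrite leq_max.
  have WR : 0 < W%:R :> R by rewrite ltr0n.
  have /W1P : (W1 <= W)%N by rewrite !leq_max leqnn !orbT.
  have /W2P : (W2 <= W)%N by rewrite !leq_max leqnn !orbT.
  have -> : p * nu%:R = 2 + e + e by rewrite /e; lra.
  rewrite !powRD_gt0 // powRr1 ?ler0n //.
  have := ln_le_powR e0 W0.
  have dW : (depth (eta W)).+1%:R <= 2 * W%:R :> R.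
    rewrite -natrM ler_nat mul2n -addnn -addn1 leq_add //.
    apply: leq_trans (depth_le_nh _) _.
    by rewrite -[X in (_ <= X)%N](etaW W W0) nh_le_nweights.
  set q := W%:R `^ e => lnW qW main.
  have q0 : 0 < q by rewrite powR_gt0.
  have : d * (W%:R * W%:R * q * q) <= W%:R * W%:R * q * (2 / e).
    apply: le_trans main _.
    apply: (@le_trans _ _ (W%:R * (2 * W%:R) * (q / e))).
      apply: ler_pM => //; first by rewrite ln_ge0 // ler1n.
      by rewrite ler_wpM2l.
    by rewrite (_ : _ * _ * _ = W%:R * W%:R * q * (2 / e)) //; ring.
  rewrite mulrCA ler_pM2l ?mulr_gt0 // leNgt => /negP; apply.
  rewrite [d * q]mulrC -ltr_pdivrMr //; apply: lt_le_trans qW.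
  by rewrite ltrDl.
- rewrite ltr_pdivrMr // => pnu [eta [asg [[a [c [a0 c0 etaW rate]]] casg]]].
  have p0 : 0 < p by rewrite -(pmulr_lgt0 _ nuR); lra.
  have [W W0 ncont] := assignment_discontinuous hnu p0 a0 c0 etaW rate pnu.
  exact: ncont (casg W W0).
- rewrite ltr_pdivrMr // -subr_gt0 => pnu _ eta asg [a [c [a0 c0 etaW rate]]].
  have p0 : 0 < p by rewrite -(pmulr_lgt0 _ nuR); lra.
  have [d d0 [W1 W1P]] := rate_depth hnu p0 a0 c0 etaW rate.
  exists (d / 2); first by rewrite divr_gt0.
  set s := p * nu%:R - 1 in pnu *.
  have s2 : 0 < s / 2 by rewrite divr_gt0.
  have [W2 W2P] := powR_eventually (2 / d / (s / 2)) s2.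
  exists (maxn 2 (maxn W1 W2)) => W; rewrite !geq_max => /and3P[W0 /W1P main /W2P big].
  have WR : 0 < W%:R :> R by rewrite ltr0n ltnW.
  have lnW : 0 < ln W%:R :> R by rewrite ln_gt0 // ltr1n.
  have lnW2 := ln_le_powR s2 (ltnW W0).
  have sE : W%:R `^ s = W%:R `^ (s / 2) * W%:R `^ (s / 2) :> R.
    by rewrite -powRD_gt0 // -splitr.
  set q := W%:R `^ (s / 2) in lnW2 big sE.
  have q0 : 0 < q by rewrite powR_gt0.
  (* [rate_depth] bounds the depth plus one from below by [Y]; once [Y] is at least 2,
     [Y / 2 <= Y - 1] absorbs the one, which is why [d] is halved. *)
  pose Y := d * W%:R `^ s / ln W%:R.
  have Y1 : Y <= (depth (eta W)).+1%:R.
    rewrite /Y ler_pdivrMr //; move: main.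
    rewrite (_ : p * nu%:R = 1 + s); last by rewrite /s addrC subrK.
    rewrite powRD_gt0 // powRr1 ?ler0n //.
    by rewrite mulrCA -mulrA ler_pM2l.
  have Y2 : 2 <= Y.
    rewrite /Y ler_pdivlMr // sE.
    apply: (@le_trans _ _ (2 * (q / (s / 2)))); first by rewrite ler_pM2l.
    rewrite mulrA ler_pdivrMr // (_ : d * _ * _ = q * (s / 2) * d * q); last by ring.
    by rewrite ler_pM2r // -ler_pdivrMr // -ler_pdivrMr.
  rewrite (_ : d / 2 * _ / _ = Y / 2); last by rewrite /Y; ring.
  by move: Y1; rewrite -natr1; lra.
Qed.
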